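(* Let $n\ge 1$, let $u>0$ be a smooth solution of the heat equation $\partial_t u=\Delta_x u$ on $\mathbb{R}^n\times(0,\infty)$, and define $f$ by $u(x,t)=t^{-n/2}e^{-f(x,t)}$. Fix $0<\tau_1<\tau_2$ and assume that $f$ and all of its partial derivatives in $x$ and $t$ are bounded on $\mathbb{R}^n\times[\tau_1,\tau_2]$. For $N\ge 3$ set $m=n+N$ and define $v,b,d_0,B$ on $\mathbb{R}^n\times(\mathbb{R}^N\setminus\{0\})$ and $D_0$ as in the context. Then there is a constant $C$ (depending on $n$, $f$, $\tau_1$, $\tau_2$, but not on $N$, $x$, $y$) such that for all $N\ge 3$ and all $(x,y)\in\mathbb{R}^n\times\mathbb{R}^N$ with $\tau:=\frac{|y|^2}{2N}\in[\tau_1,\tau_2]$, \[ \Big|\frac{\Delta(d_0 v)}{v}(x,y)-\frac{m}{b(x,y)^2}|B(x,y)|^2\Big|\le \frac{C}{N},\qquad \big|d_0(x,y)-4D_0(x,\tau)\big|\le\frac{C}{N}, \] \[ \Big|\frac{\Delta(d_0 v)}{v}(x,y)+4\,\frac{\Box(D_0u)}{u}(x,\tau)\Big|\le\frac{C}{N}. \]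
   Context: Points of $\mathbb{R}^m=\mathbb{R}^n\times\mathbb{R}^N$ are written $(x,y)$, $r=|y|$. On $\mathbb{R}^m$, $\nabla$, $\Delta$ and $\mathrm{Hess}$ denote the Euclidean gradient, Laplacian and Hessian in all $m$ variables. Definitions: $v(x,y)=r^{2-m}\exp\big(-f(x,\tfrac{r^2}{2N})\big)$ (equivalently $v=(2N)^{-n/2}|y|^{2-N}u(x,|y|^2/(2N))$); $b=v^{1/(2-m)}$; the elliptic deficit $d_0=2m(|\nabla b|^2-1)$; $B=\mathrm{Hess}(b^2)-\frac{\Delta b^2}{m}I_m$ (the trace-free Hessian of $b^2$), $|B|^2$ its squared Hilbert–Schmidt norm. The parabolic deficit is $D_0(x,t)=t\,(|\nabla_x f|^2+f_t)+\partial_t(t f)$, and $\Box=\partial_t-\Delta_x$ on $\mathbb{R}^n\times(0,\infty)$. *)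

(* Defs.v *)
From HB Require Import structures.
From mathcomp Require Import all_boot all_order all_algebra.
From mathcomp Require Import all_classical all_reals all_analysis.
Unset Printing Implicit Defensive.
Import Order.TTheory GRing.Theory Num.Theory.
Import numFieldNormedType.Exports.
Local Open Scope ring_scope.
Local Open Scope classical_set_scope.

Definition xdir {R : realType} {n : nat} (i : 'I_n) : 'rV[R]_n * R :=
  (delta_mx 0 i, 0).
Definition tdir {R : realType} {n : nat} : 'rV[R]_n * R := (0, 1).
Definition cdir {R : realType} {n : nat} (o : option 'I_n) : 'rV[R]_n * R :=
  if o is Some i then xdir i else tdir.

Definition Dp {R : realType} {n : nat} (s : seq (option 'I_n))
  (G : 'rV[R]_n * R -> R) : 'rV[R]_n * R -> R :=
  foldr (fun o g => 'D_(cdir o) g) G s.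

Definition smooth_on {R : realType} {n : nat} (U : set ('rV[R]_n * R))
  (G : 'rV[R]_n * R -> R) : Prop :=
  forall (s : seq (option 'I_n)) (p : 'rV[R]_n * R), U p -> differentiable (Dp s G) p.

Definition lapx {R : realType} {n : nat} (G : 'rV[R]_n * R -> R) (p : 'rV[R]_n * R) : R :=
  \sum_(i < n) 'D_(xdir i) ('D_(xdir i) G) p.

Definition heatop {R : realType} {n : nat} (G : 'rV[R]_n * R -> R) (p : 'rV[R]_n * R) : R :=
  'D_tdir G p - lapx G p.

Definition D0 {R : realType} {n : nat} (f : 'rV[R]_n * R -> R) (p : 'rV[R]_n * R) : R :=
  p.2 * (\sum_(i < n) ('D_(xdir i) f p) ^+ 2 + 'D_tdir f p)
  + 'D_tdir (fun q : 'rV[R]_n * R => q.2 * f q) p.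

Definition sqnorm {R : realType} {k : nat} (y : 'rV[R]_k) : R := \sum_(j < k) y 0 j ^+ 2.
Definition enorm {R : realType} {k : nat} (y : 'rV[R]_k) : R := Num.sqrt (sqnorm y).

Definition pd {R : realType} {k : nat} (i : 'I_k) (F : 'rV[R]_k -> R) : 'rV[R]_k -> R :=
  'D_(delta_mx 0 i) F.

Definition lap {R : realType} {k : nat} (F : 'rV[R]_k -> R) (z : 'rV[R]_k) : R :=
  \sum_(i < k) pd i (pd i F) z.
Definition hess {R : realType} {k : nat} (F : 'rV[R]_k -> R) (z : 'rV[R]_k) : 'M[R]_k :=
  \matrix_(i, j) pd i (pd j F) z.
Definition gradsq {R : realType} {k : nat} (F : 'rV[R]_k -> R) (z : 'rV[R]_k) : R :=
  \sum_(i < k) (pd i F z) ^+ 2.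
Definition hs2 {R : realType} {k : nat} (A : 'M[R]_k) : R :=
  \sum_(i < k) \sum_(j < k) A i j ^+ 2.

Definition vfun {R : realType} (n N : nat) (f : 'rV[R]_n * R -> R)
  (z : 'rV[R]_(n + N)) : R :=
  let x := lsubmx z in let y := rsubmx z in let r := enorm y in
  r `^ (2 - (n + N)%:R) * expR (- f (x, r ^+ 2 / (2 * N%:R))).

Definition bfun {R : realType} (n N : nat) (f : 'rV[R]_n * R -> R)
  (z : 'rV[R]_(n + N)) : R :=
  vfun n N f z `^ (1 / (2 - (n + N)%:R)).

Definition d0fun {R : realType} (n N : nat) (f : 'rV[R]_n * R -> R)
  (z : 'rV[R]_(n + N)) : R :=
  2 * (n + N)%:R * (gradsq (bfun n N f) z - 1).

Definition Bmat {R : realType} (n N : nat) (f : 'rV[R]_n * R -> R)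
  (z : 'rV[R]_(n + N)) : 'M[R]_(n + N) :=
  hess (fun w => bfun n N f w ^+ 2) z
  - (lap (fun w => bfun n N f w ^+ 2) z / (n + N)%:R)%:M.

(* Main.v *)
(** With t = |y|^2/(2N), the Laplacian of R^(n+N) acts on F(x, t) as
    lap_x F + F_t + (2t/N) F_tt.  Put eps = 1/(m-2); then b = sqrt(2Nt) exp(eps f)
    and d_0 = 4 D_0 + eps G as functions of (x, t), where all derivatives of G are
    bounded uniformly in N.  Conjugating by v turns lap(d_0 v)/v into
    lap_x d_0 - (d_0)_t - 2 grad d_0 . grad f + O(1/N), which is
    -4 Box(D_0 u)/u + O(1/N).  A Bochner identity for D_0, using
    f_t = lap_x f - |grad f|^2 - n/(2t), rewrites this as 8t |Hess f - I/(2t)|^2.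
    On the other hand b^2 = |y|^2 + 4tf + O(1/N) with derivatives, so only the
    x-block 4t Hess f - 2I of B survives at leading order, and
    m/b^2 = 1/(2t) + O(1/N). *)

Require Import Defs.
From HB Require Import structures.
From mathcomp Require Import all_boot all_order all_algebra.
From mathcomp Require Import all_classical all_reals all_analysis.
From mathcomp Require Import ring lra zify.
Import Order.TTheory GRing.Theory Num.Theory.
Import numFieldNormedType.Exports.
Set Implicit Arguments.
Unset Strict Implicit.
Unset Printing Implicit Defensive.
Local Open Scope ring_scope.
Local Open Scope classical_set_scope.

(** Each estimate comes from an exact identity, left side = main term + (1/N) * remainder, so no
    error term is ever differentiated after being estimated. The remainders are built by sums,
    products and derivatives from f, t, 1/t, the bounded ratios 1/N, 1/(m-2), N/(m-2), N/m and two
    Taylor quotients of exp(c eps f). Uniformity in N then holds because the families bounded with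
    all derivatives independently of N form an algebra closed under differentiation; the only real
    analytic estimates are those for the Taylor quotients, which divide by eps. The obstacle is that
    v and b lie outside this class: log v has a t-derivative of size N and b^2 grows like N. So v is
    conjugated away, its contributions of size N cancelling exactly, and only b^2 - 2Nt is treated
    as bounded. Bounds are given on the closed strip of times alone, whereas derivatives are local;
    smoothness and identities therefore live on t > 0, and only bounds on the strip. *)

Lemma near_eq_differentiable (R : numFieldType) (V W : normedModType R)
    (f g : V -> W) (a : V) :
  {near a, f =1 g} -> differentiable f a -> differentiable g a.
Proof.
move=> fg /diff_locallyP[fc fo].
(* The first-order expansion of [f] at [a], with its own differential, is also one for [g];
   uniqueness of the differential then identifies it. *)
have go : g \o shift a = cst (g a) + 'd f a +o_ 0 id.
  apply/eqaddoP => e e0.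
  have /eqaddoP/(_ e e0) := fo.
  have : \forall h \near (0 : V), f (h + a) = g (h + a).
    have := near_shift 0 a (fun x => f x = g x).
    by rewrite subr0 /= => <-.
  apply: filterS2 => h fgh; rewrite /= !fctE /= fgh.
  by rewrite (nbhs_singleton fg).
apply/diff_locallyP; rewrite (diff_unique fc go); split; [exact: fc | exact: go].
Qed.

(** * Rules for directional derivatives *)

Section DirectionalDerivative.
Context {R : realType} {V : normedModType R}.
Implicit Types (F G : V -> R) (p v : V) (a b : R).

(* Differentiability is bundled with the value of the derivative so that both
   are computed in one pass. *)
Definition has_dv F v p a := differentiable F p /\ 'D_v F p = a.

Lemma has_dv_self F v p : differentiable F p -> has_dv F v p ('D_v F p).
Proof. by []. Qed.

Lemma has_dv_cst c v p : has_dv (fun=> c) v p 0.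
Proof. by split; [exact: differentiable_cst | exact: derive_cst]. Qed.

Lemma has_dvD F G v p a b : has_dv F v p a -> has_dv G v p b ->
  has_dv (fun q => F q + G q) v p (a + b).
Proof.
by move=> [dF <-] [dG <-]; split; [exact: differentiableD |
  rewrite -deriveD//; exact: diff_derivable].
Qed.

Lemma has_dvN F v p a : has_dv F v p a -> has_dv (fun q => - F q) v p (- a).
Proof.
by move=> [dF <-]; split; [exact: differentiableN |
  rewrite -deriveN//; exact: diff_derivable].
Qed.

Lemma has_dvB F G v p a b : has_dv F v p a -> has_dv G v p b ->
  has_dv (fun q => F q - G q) v p (a - b).
Proof. by move=> dF dG; apply: has_dvD => //; exact: has_dvN. Qed.

Lemma has_dvM F G v p a b : has_dv F v p a -> has_dv G v p b ->
  has_dv (fun q => F q * G q) v p (a * G p + F p * b).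
Proof.
move=> [dF <-] [dG <-]; split; first exact: differentiableM.
rewrite -[LHS]/('D_v (F * G) p) deriveM; [|exact: diff_derivable..].
by rewrite /GRing.scale/= addrC mulrC [F p * _]mulrC mulrC [_ * F p]mulrC.
Qed.

Lemma has_dvX2 F v p a : has_dv F v p a ->
  has_dv (fun q => F q ^+ 2) v p (2 * F p * a).
Proof.
move=> dF; have [d1 d2] := has_dvM dF dF; split.
  by under eq_fun do rewrite expr2.
have -> : (fun q => F q ^+ 2) = (fun q => F q * F q).
  by apply/funext => q; rewrite expr2.
by rewrite d2; ring.
Qed.

Lemma has_dv_sum k (F : 'I_k -> V -> R) v p (a : 'I_k -> R) :
  (forall i, has_dv (F i) v p (a i)) ->
  has_dv (fun q => \sum_i F i q) v p (\sum_i a i).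
Proof.
elim: k F a => [|k IH] F a dF.
  under eq_fun do rewrite big_ord0.
  by rewrite big_ord0; exact: has_dv_cst.
under eq_fun do rewrite big_ord_recl.
by rewrite big_ord_recl; apply: has_dvD => //; apply: IH => i; exact: dF.
Qed.

Lemma has_dv_comp (h : R -> R) (dh : R) F v p a : is_derive (F p) 1 h dh ->
  has_dv F v p a -> has_dv (fun q => h (F q)) v p (dh * a).
Proof.
move=> [hF <-] [dF <-].
have dh1 : differentiable h (F p) by exact/derivable1_diffP.
split; first exact: differentiable_comp.
rewrite deriveE; last exact: differentiable_comp.
(* The differential of [h] is a linear map of the line, hence multiplication by its value at 1. *)
rewrite diff_comp//= deriveE// -[in LHS](mulr1 ('d F p v)).
by rewrite -[_ * 1]/(_ *: 1) linearZ/= -deriveE// mulrC.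
Qed.

Lemma has_dv_exp F v p a : has_dv F v p a ->
  has_dv (fun q => expR (F q)) v p (a * expR (F p)).
Proof.
by move=> dF; rewrite mulrC; apply: has_dv_comp dF; exact: is_derive_expR.
Qed.

Lemma has_dv_ln F v p a : 0 < F p -> has_dv F v p a ->
  has_dv (fun q => ln (F q)) v p (a / F p).
Proof.
by move=> F0 dF; rewrite mulrC; apply: has_dv_comp dF; exact: is_derive1_ln.
Qed.

Lemma has_dvV F v p a : F p != 0 -> has_dv F v p a ->
  has_dv (fun q => (F q)^-1) v p (- a * (F p)^-1 * (F p)^-1).
Proof.
move=> F0 [dF <-]; split; first exact: differentiableV.
rewrite deriveV//; last exact: diff_derivable.
by rewrite /GRing.scale/= expr2 invfM; ring.
Qed.

End DirectionalDerivative.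


(** * The algebra of smooth families bounded uniformly in the dimension *)

Section BoundedSmoothFamilies.
Context {R : realType} {n : nat}.
Local Notation P := ('rV[R]_n * R)%type.
Local Notation U := [set p : P | 0 < p.2].
Implicit Types (F G : nat -> P -> R) (p : P) (S : set P).

Lemma pos_time_nbhs p : U p -> nbhs p U.
Proof.
move=> p0; apply: (@open_nbhs_nbhs _ p); split => //.
have -> : U = snd @^-1` [set t : R | 0 < t] by [].
apply: open_comp; last exact: open_gt.
by move=> q _; exact: cvg_snd.
Qed.

Lemma near_pos_time (g h : P -> R) p : U p -> (forall q, U q -> g q = h q) ->
  {near p, g =1 h}.
Proof. by move=> p0 gh; apply: filterS (pos_time_nbhs p0) => q /gh. Qed.

Lemma derive_pos_time (g h : P -> R) v p : U p ->
  (forall q, U q -> g q = h q) -> 'D_v g p = 'D_v h p.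
Proof. by move=> p0 gh; apply: near_eq_derive; exact: near_pos_time. Qed.

Lemma differentiable_pos_time (g h : P -> R) p : U p ->
  (forall q, U q -> g q = h q) -> differentiable g p -> differentiable h p.
Proof. by move=> p0 gh; apply: near_eq_differentiable; exact: near_pos_time. Qed.

(** The bound is chosen before the index [k]; this order of quantifiers is what makes the final
    constant independent of N. *)
Definition bnd S F := exists M : R, forall k p, S p -> `|F k p| <= M.

Lemma bnd_eq S F G : (forall k p, S p -> F k p = G k p) -> bnd S F -> bnd S G.
Proof. by move=> FG [M FM]; exists M => k p Sp; rewrite -FG// FM. Qed.

Lemma bnd_cst S (c : nat -> R) M : (forall k, `|c k| <= M) ->
  bnd S (fun k _ => c k).
Proof. by move=> cM; exists M => k p _; exact: cM. Qed.

Lemma bndD S F G : bnd S F -> bnd S G -> bnd S (fun k p => F k p + G k p).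
Proof.
move=> [M FM] [M' GM]; exists (M + M') => k p Sp.
by apply: le_trans (ler_normD _ _) _; apply: lerD; [exact: FM|exact: GM].
Qed.

Lemma bndM S F G : bnd S F -> bnd S G -> bnd S (fun k p => F k p * G k p).
Proof.
move=> [M FM] [M' GM]; exists (M * M') => k p Sp.
by rewrite normrM; apply: ler_pM => //; [exact: FM|exact: GM].
Qed.

Lemma bnd_exp S F : bnd S F -> bnd S (fun k p => expR (F k p)).
Proof.
move=> [M FM]; exists (expR M) => k p Sp.
by rewrite ger0_norm ?expR_ge0// ler_expR (le_trans (ler_norm _))// FM.
Qed.

(* Smoothness is required on all of t > 0, bounds only on S but uniformly in the
   index of the family; S = set0 is mere smoothness. *)
Fixpoint Ckbnd S j F : Prop :=
  [/\ forall k p, U p -> differentiable (F k) p, bnd S F &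
  if j is j'.+1 then forall o, Ckbnd S j' (fun k => 'D_(cdir o) (F k)) else True].

Definition good S F := forall j, Ckbnd S j F.

Lemma CkbndW S j F : Ckbnd S j.+1 F -> Ckbnd S j F.
Proof.
elim: j F => [|j IH] F [dF bF DF]; first by split.
by split => // o; apply: IH; exact: DF.
Qed.

Lemma Ckbnd_diff S j F k p : Ckbnd S j F -> U p -> differentiable (F k) p.
Proof. by case: j => [|j] [dF _ _]; exact: dF. Qed.

Lemma good_diff S F k p : good S F -> U p -> differentiable (F k) p.
Proof. by move=> /(_ 0%N); exact: Ckbnd_diff. Qed.

Lemma good_bnd S F : good S F -> bnd S F.
Proof. by move=> /(_ 0%N)[]. Qed.

Lemma good_D S F o : good S F -> good S (fun k => 'D_(cdir o) (F k)).
Proof. by move=> gF j; have [_ _] := gF j.+1; exact. Qed.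

(** Serves functions whose derivatives lie in the class for simple algebraic reasons although their
    own bound needs a separate argument, such as Taylor quotients. *)
Lemma good_of_D S F : (forall k p, U p -> differentiable (F k) p) -> bnd S F ->
  (forall o, good S (fun k => 'D_(cdir o) (F k))) -> good S F.
Proof. by move=> dF bF DF [|j]; split => // o; exact: DF. Qed.

Lemma good_smooth S (u : P -> R) : smooth_on U u ->
  (forall s, bnd S (fun _ => Dp s u)) -> good S (fun=> u).
Proof.
move=> su bu; suff H s : good S (fun=> Dp s u) by exact: (H [::]).
move=> j; elim: j s => [|j IH] s; first by split => // k; exact: su.
by split => // [k|o]; [exact: su | exact: (IH (o :: s))].
Qed.

Lemma bnd_set0 F : bnd set0 F.
Proof. by exists 0. Qed.

Section Closure.
Variables (S : set P) (SU : S `<=` U).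

(** Derivatives are local and t > 0 is open, so agreement there passes to all orders. This allows a
    derivative to be replaced by its computed formula. *)
Lemma Ckbnd_eq j F G : (forall k p, U p -> F k p = G k p) ->
  Ckbnd S j F -> Ckbnd S j G.
Proof.
elim: j F G => [|j IH] F G FG [dF bF DF].
  split=> //; last by apply: bnd_eq bF => k p /SU; exact: FG.
  by move=> k p p0; apply: differentiable_pos_time (dF k p p0) => // q; exact: FG.
split; last 1 first.
- move=> o; apply: IH (DF o) => k p p0.
  by apply: derive_pos_time => // q; exact: FG.
- by move=> k p p0; apply: differentiable_pos_time (dF k p p0) => // q; exact: FG.
- by apply: bnd_eq bF => k p /SU; exact: FG.
Qed.

Lemma good_eq F G : (forall k p, U p -> F k p = G k p) -> good S F -> good S G.
Proof. by move=> FG gF j; exact: Ckbnd_eq (gF j). Qed.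

Lemma CkbndD j F G : Ckbnd S j F -> Ckbnd S j G ->
  Ckbnd S j (fun k p => F k p + G k p).
Proof.
elim: j F G => [|j IH] F G [dF bF DF] [dG bG DG].
  by split=> //; [move=> k p p0; apply: differentiableD; auto | exact: bndD].
split=> [k p p0||o]; [by apply: differentiableD; auto | exact: bndD |].
apply: Ckbnd_eq (IH _ _ (DF o) (DG o)) => k p p0.
by have [_ ->] := has_dvD (has_dv_self (cdir o) (dF k p p0))
  (has_dv_self (cdir o) (dG k p p0)).
Qed.

(** In the Leibniz rule one factor stays undifferentiated, which is why its order has to be lowered
    by [CkbndW]. *)
Lemma CkbndM j F G : Ckbnd S j F -> Ckbnd S j G ->
  Ckbnd S j (fun k p => F k p * G k p).
Proof.
elim: j F G => [|j IH] F G cF cG; have [dF bF DF] := cF; have [dG bG DG] := cG.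
  by split=> //; [move=> k p p0; apply: differentiableM; auto | exact: bndM].
split=> [k p p0||o]; [by apply: differentiableM; auto | exact: bndM |].
apply: Ckbnd_eq (CkbndD (IH _ _ (DF o) (CkbndW cG)) (IH _ _ (CkbndW cF) (DG o))).
move=> k p p0.
by have [_ ->] := has_dvM (has_dv_self (cdir o) (dF k p p0))
  (has_dv_self (cdir o) (dG k p p0)).
Qed.

Lemma Ckbnd_cst j (c : nat -> R) M : (forall k, `|c k| <= M) ->
  Ckbnd S j (fun k _ => c k).
Proof.
elim: j c M => [|j IH] c M cM; split => //.
- exact: bnd_cst cM.
- exact: bnd_cst cM.
move=> o; apply: (@Ckbnd_eq _ (fun _ _ => 0)); last first.
  by apply: (IH _ 0) => k; rewrite normr0.
by move=> k p _; rewrite -[RHS]/('D_(cdir o) (cst (c k)) p) derive_cst.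
Qed.

Lemma good_cst (c : R) : good S (fun _ _ => c).
Proof. by move=> j; apply: (@Ckbnd_cst _ (fun=> c) `|c|). Qed.

Lemma good_coef (c : nat -> R) M : (forall k, `|c k| <= M) ->
  good S (fun k _ => c k).
Proof. by move=> cM j; exact: Ckbnd_cst cM. Qed.

Lemma goodD F G : good S F -> good S G -> good S (fun k p => F k p + G k p).
Proof. by move=> gF gG j; exact: CkbndD. Qed.

Lemma goodM F G : good S F -> good S G -> good S (fun k p => F k p * G k p).
Proof. by move=> gF gG j; exact: CkbndM. Qed.

Lemma goodN F : good S F -> good S (fun k p => - F k p).
Proof.
move=> gF; apply: good_eq (goodM (good_cst (-1)) gF) => k p _.
by rewrite mulN1r.
Qed.

Lemma goodX F j : good S F -> good S (fun k p => F k p ^+ j).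
Proof.
move=> gF; elim: j => [|j IH].
  by apply: good_eq (good_cst 1) => k p _; rewrite expr0.
by apply: good_eq (goodM gF IH) => k p _; rewrite exprS.
Qed.

Lemma good_sum m (F : 'I_m -> nat -> P -> R) :
  (forall i, good S (F i)) -> good S (fun k p => \sum_i F i k p).
Proof.
elim: m F => [|m IH] F gF.
  by apply: good_eq (good_cst 0) => k p _; rewrite big_ord0.
apply: good_eq (goodD (gF ord0) (IH (fun i => F (lift ord0 i)) (fun i => gF _))).
by move=> k p _; rewrite big_ord_recl.
Qed.

(** The derivative of exp F contains exp F again. With differentiability and the bound settled
    beforehand, the induction on the order may use its own hypothesis for that factor; [goodV] has
    the same structure. *)
Lemma good_exp F : good S F -> good S (fun k p => expR (F k p)).
Proof.
move=> gF j.
have d k p : U p -> differentiable (fun q => expR (F k q)) p.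
  by move=> p0; have [] := has_dv_exp (has_dv_self 0 (good_diff k gF p0)).
have b := bnd_exp (good_bnd gF).
elim: j => [|j IH]; split => // o.
apply: Ckbnd_eq (CkbndM (good_D o gF j) IH) => k p p0.
by have [_ ->] := has_dv_exp (has_dv_self (cdir o) (good_diff k gF p0)).
Qed.

Lemma goodV F : good S F -> (forall k p, U p -> F k p != 0) ->
  bnd S (fun k p => (F k p)^-1) -> good S (fun k p => (F k p)^-1).
Proof.
move=> gF F0 b j.
have d k p : U p -> differentiable (fun q => (F k q)^-1) p.
  by move=> p0; have [] := has_dvV (F0 k p p0) (has_dv_self 0 (good_diff k gF p0)).
elim: j => [|j IH]; split => // o.
apply: Ckbnd_eq (CkbndM (CkbndM (goodN (good_D o gF) j) IH) IH) => k p p0.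
by have [_ ->] := has_dvV (F0 k p p0) (has_dv_self (cdir o) (good_diff k gF p0)).
Qed.

Lemma good_time : bnd S (fun _ p => p.2) -> good S (fun _ p => p.2).
Proof.
have dt (p : P) : differentiable (fun q : P => q.2) p.
  by apply: (@linear_differentiable _ _ _ (@snd 'rV[R]_n R)) => q; exact: cvg_snd.
move=> b; apply: good_of_D => // o.
pose c := if o is Some _ then 0 else 1 : R.
apply: good_eq (good_cst c) => k p p0.
rewrite deriveE// (@diff_lin _ _ _ (@snd 'rV[R]_n R)) //; last by move=> q; exact: cvg_snd.
by rewrite /c; case: (o).
Qed.

End Closure.

(** Stated with empty [S]: logarithms enter only through ln t, ln u and the exponents of v and b,
    where smoothness is what matters. *)
Lemma good_ln F : good set0 F -> (forall k p, U p -> 0 < F k p) ->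
  good set0 (fun k p => ln (F k p)).
Proof.
move=> gF F0.
have d k p : U p -> differentiable (fun q => ln (F k q)) p.
  by move=> p0; have [] := has_dv_ln (F0 k p p0) (has_dv_self 0 (good_diff k gF p0)).
apply: good_of_D => //; first exact: bnd_set0.
move=> o; apply: (@good_eq _ _ (fun k p => 'D_(cdir o) (F k) p * (F k p)^-1)) => //.
  move=> k p p0.
  by have [_ ->] := has_dv_ln (F0 k p p0) (has_dv_self (cdir o) (good_diff k gF p0)).
apply: goodM => //; first exact: good_D.
by apply: goodV => // [k p p0|]; [rewrite gt_eqF ?F0 | exact: bnd_set0].
Qed.

End BoundedSmoothFamilies.

(** * Symmetry of second derivatives *)

Lemma ler_dist_half (R : realFieldType) (a b c e : R) :
  `|a - c| < e / 2 -> `|b - c| < e / 2 -> `|a - b| <= e.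
Proof.
move=> ac bc; apply: le_trans (ler_distD c a b) _; rewrite (distrC c) [e]splitr.
by apply: lerD; apply: ltW.
Qed.

Section Schwarz.
Context {R : realType} {V : normedModType R}.
Implicit Types (F : V -> R) (p q v w : V).

Lemma is_derive_line F v q (s : R) : derivable F (s *: v + q) v ->
  is_derive s 1 (fun t => F (t *: v + q)) ('D_v F (s *: v + q)).
Proof.
have E : (fun h : R => h^-1 *: (F ((h *: (1 : R) + s) *: v + q) - F (s *: v + q)))
       = (fun h : R => h^-1 *: (F (h *: v + (s *: v + q)) - F (s *: v + q))).
  by apply/funext => h; rewrite [h *: 1]mulr1 scalerDl addrA.
by move=> dF; split; rewrite /derivable /derive/= E.
Qed.

Lemma MVT_line F v q (h : R) : 0 < h ->
  (forall s, 0 <= s <= h -> differentiable F (s *: v + q)) ->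
  exists2 s, 0 < s < h & F (h *: v + q) - F q = h * 'D_v F (s *: v + q).
Proof.
move=> h0 dF.
have D s : 0 <= s <= h ->
    is_derive s 1 (fun t => F (t *: v + q)) ('D_v F (s *: v + q)).
  by move=> sh; apply: is_derive_line; apply: diff_derivable; exact: dF.
have [||s] := @MVT R (fun t => F (t *: v + q)) (fun s => 'D_v F (s *: v + q)) 0 h h0.
- by move=> s /[!in_itv]/= /andP[s0 sh]; apply: D; rewrite !ltW.
- apply: derivable_within_continuous => s /[!in_itv]/= sh.
  by have [] := D s sh.
rewrite in_itv/= => sh; rewrite subr0 scale0r add0r mulrC => e.
by exists s.
Qed.

Lemma derive_shiftr F v q c : 'D_v (fun x => F (x + c)) q = 'D_v F (q + c).
Proof.
have E : (fun h : R => h^-1 *: (F (h *: v + q + c) - F (q + c))) =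
         (fun h : R => h^-1 *: (F (h *: v + (q + c)) - F (q + c))).
  by apply/funext => h; rewrite addrA.
by rewrite /derive/= E.
Qed.

Lemma differentiable_shiftr F q c : differentiable F (q + c) ->
  differentiable (fun x => F (x + c)) q.
Proof.
move=> dF; apply: (@differentiable_comp _ _ _ _ (fun x => x + c) F) => //.
Qed.

(** The mean value theorem is used twice: along [v] for the increment of F by h w, then along [w]
    for the derivative of F in direction [v]. *)
Lemma second_difference_MVT F v w p (h : R) : 0 < h ->
  (forall s t, 0 <= s <= h -> 0 <= t <= h ->
     differentiable F (t *: w + (s *: v + p)) /\
     differentiable ('D_v F) (t *: w + (s *: v + p))) ->
  exists s t, [/\ 0 < s < h, 0 < t < h &
    F (p + h *: v + h *: w) - F (p + h *: v) - (F (p + h *: w) - F p)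
    = h ^+ 2 * 'D_w ('D_v F) (t *: w + (s *: v + p))].
Proof.
move=> h0 dF; have h0h : 0 <= (0 : R) <= h by rewrite lexx ltW.
have hhh : 0 <= h <= h by rewrite lexx ltW.
have dF0 s : 0 <= s <= h -> differentiable F (s *: v + p).
  by move=> /dF /(_ h0h)[]; rewrite scale0r add0r.
have dFh s : 0 <= s <= h -> differentiable F (s *: v + p + h *: w).
  by move=> /dF /(_ hhh)[]; rewrite addrC.
have [s sh E] := @MVT_line (fun x => F (x + h *: w) - F x) v p h h0
  (fun s sh => differentiableB (differentiable_shiftr (dFh s sh)) (dF0 s sh)).
have sh' : 0 <= s <= h by case/andP: sh => s0 s1; rewrite !ltW.
have [|t th E2] := @MVT_line ('D_v F) w (s *: v + p) h h0.
  by move=> t th; have [] := dF s t sh' th.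
exists s, t; split => //; rewrite (addrC p (h *: v)) E expr2 -mulrA -E2; congr (_ * _).
have [_ ->] := has_dvB (has_dv_self v (differentiable_shiftr (dFh s sh')))
   (has_dv_self v (dF0 s sh')).
by rewrite derive_shiftr [h *: w + _]addrC.
Qed.

(** The second difference of F is symmetric in [v] and [w]. Each order of differentiation expresses
    it as h^2 times a mixed derivative at some point near p, and continuity brings both values to
    p. *)
Theorem schwarz F v w p :
  (\forall q \near p, [/\ differentiable F q, differentiable ('D_v F) q &
                         differentiable ('D_w F) q]) ->
  {for p, continuous ('D_w ('D_v F))} -> {for p, continuous ('D_v ('D_w F))} ->
  'D_w ('D_v F) p = 'D_v ('D_w F) p.
Proof.
move=> dF cwv cvw; apply/eqP; rewrite -subr_eq0 -normr_le0.
apply/ler_addgt0Pr => e e0; rewrite add0r; have e20 : 0 < e / 2 by rewrite divr_gt0.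
have : \forall q \near p, [/\ differentiable F q, differentiable ('D_v F) q &
    differentiable ('D_w F) q] /\
    (`|'D_w ('D_v F) p - 'D_w ('D_v F) q| < e / 2 /\
     `|'D_v ('D_w F) p - 'D_v ('D_w F) q| < e / 2).
  apply: filterI dF _; apply: filterI.
  - by have /cvgrPdist_lt/(_ _ e20) := cwv.
  - by have /cvgrPdist_lt/(_ _ e20) := cvw.
move=> /nbhs_normP[r /= r0 rP].
(* The added 1 keeps [K] positive when both directions vanish; h K = r/2 then places all
   intermediate points inside the ball of radius r. *)
pose K := `|v| + `|w| + 1; have K0 : 0 < K by rewrite ltr_wpDl// addr_ge0.
pose h := r / 2 / K; have h0 : 0 < h by rewrite !divr_gt0.
have near_p a b (x y : V) : 0 <= a <= h -> 0 <= b <= h -> `|x| + `|y| <= `|v| + `|w| ->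
    ball_ Num.norm p r (a *: x + (b *: y + p)).
  move=> /andP[a0 ah] /andP[b0 bh] xy; rewrite /ball_/= addrA opprD addrA addrAC subrr add0r normrN.
  apply: le_lt_trans (ler_normD _ _) _; rewrite !normrZ !ger0_norm//.
  apply: (@le_lt_trans _ _ (h * (`|x| + `|y|))).
    by rewrite mulrDr; apply: lerD; apply: ler_wpM2r.
  apply: (@le_lt_trans _ _ (h * K)).
    apply: ler_wpM2l; first exact: ltW.
    by apply: le_trans xy _; rewrite lerDl.
  by rewrite /h divfK ?gt_eqF// ltr_pdivrMr// ltr_pMr// ltr1n.
have vw : `|v| + `|w| <= `|v| + `|w| by [].
have wv : `|w| + `|v| <= `|v| + `|w| by rewrite addrC.
have [s [t [/andP[s0 sh] /andP[t0 th] E1]]] := @second_difference_MVT F v w p h h0 (fun s t sh th =>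
  let H := (rP _ (near_p _ _ _ _ th sh wv)).1 in
  conj (let: And3 a _ _ := H in a) (let: And3 _ b _ := H in b)).
have [s' [t' [/andP[s'0 s'h] /andP[t'0 t'h] E2]]] := @second_difference_MVT F w v p h h0 (fun s t sh th =>
  let H := (rP _ (near_p _ _ _ _ th sh vw)).1 in
  conj (let: And3 a _ _ := H in a) (let: And3 _ _ b := H in b)).
have I (x : R) : 0 < x -> x < h -> 0 <= x <= h by move=> *; rewrite !ltW.
have /rP[_ [H1 _]] := near_p t s w v (I _ t0 th) (I _ s0 sh) wv.
have /rP[_ [_ H2]] := near_p t' s' v w (I _ t'0 t'h) (I _ s'0 s'h) vw.
have E : 'D_w ('D_v F) (t *: w + (s *: v + p)) = 'D_v ('D_w F) (t' *: v + (s' *: w + p)).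
  (* Cancel h^2: both sides become the same second difference, up to the order of its terms. *)
  apply: (@mulfI _ (h ^+ 2)); first by rewrite expf_neq0// gt_eqF.
  apply: (etrans (esym E1)); apply: etrans E2; rewrite (addrAC p (h *: w)).
  by move: (F _) (F _) (F _) (F _) => a b c d; ring.
rewrite E in H1; exact: ler_dist_half H1 H2.
Qed.

End Schwarz.

Lemma good_schwarz (R : realType) (n : nat) S (F : nat -> 'rV[R]_n * R -> R)
    k o o' p : good S F -> 0 < p.2 ->
  'D_(cdir o) ('D_(cdir o') (F k)) p = 'D_(cdir o') ('D_(cdir o) (F k)) p.
Proof.
move=> gF p0.
apply: schwarz.
- apply: filterS (pos_time_nbhs p0) => q q0.
  by split; [exact: (good_diff k gF) | exact: (good_diff k (good_D _ gF))..].
- by apply: differentiable_continuous; exact: (good_diff k (good_D _ (good_D _ gF))).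
- by apply: differentiable_continuous; exact: (good_diff k (good_D _ (good_D _ gF))).
Qed.

Arguments cdir : simpl never.

(** * Calculus of functions of x and |y|^2/(2N) on R^(n+N) *)

Section Pullback.
Context {R : realType} {n N : nat}.
Local Notation P := ('rV[R]_n * R)%type.
Local Notation U := [set p : P | 0 < p.2].
Local Notation E := 'rV[R]_(n + N).
Implicit Types (z : E) (F : nat -> P -> R).

Definition pull z : P := (lsubmx z, sqnorm (rsubmx z) / (2 * N%:R)).

Arguments pull : simpl never.
Local Notation t z := (pull z).2.
Local Notation y z j := (z 0 (rshift n j)).

Lemma has_dv_coord (i j : 'I_(n + N)) z :
  has_dv (fun w : E => w 0 j) (delta_mx 0 i) z (j == i)%:R.
Proof.
split; first exact: differentiable_coord.
have d : derivable (id : E -> E) z (delta_mx 0 i) by exact: derivable_id.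
have := derive_mx d.
by rewrite derive_id => /matrixP/(_ 0 j); rewrite !mxE eqxx/= => ->.
Qed.

Lemma pull_time z : t z = (\sum_j y z j ^+ 2) / (2 * N%:R).
Proof. by congr (_ / _); apply: eq_bigr => j _; rewrite mxE. Qed.

Lemma has_dv_time_l (i : 'I_n) z :
  has_dv (fun w => t w) (delta_mx 0 (lshift N i)) z 0.
Proof.
have H := has_dvM (has_dv_sum (fun j => has_dvX2 (has_dv_coord (lshift N i) (rshift n j) z)))
  (has_dv_cst (2 * N%:R)^-1 (delta_mx 0 (lshift N i)) z).
under eq_fun do rewrite pull_time.
case: H => ? H; split => //; rewrite H mulr0 addr0 big1 ?mul0r// => j _.
by rewrite eq_rlshift mulr0.
Qed.

Lemma has_dv_time_r (j : 'I_N) z :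
  has_dv (fun w => t w) (delta_mx 0 (rshift n j)) z (y z j / N%:R).
Proof.
have H := has_dvM (has_dv_sum (fun l => has_dvX2 (has_dv_coord (rshift n j) (rshift n l) z)))
  (has_dv_cst (2 * N%:R)^-1 (delta_mx 0 (rshift n j)) z).
under eq_fun do rewrite pull_time.
case: H => ? H; split => //; rewrite H mulr0 addr0 (bigD1 j)//= big1 ?addr0.
  by rewrite eqxx mulr1 invfM; move: (N%:R^-1) => c; field.
by move=> l lj; rewrite eq_rshift (negbTE lj) mulr0.
Qed.

Lemma differentiable_time z : differentiable (fun w => t w) z.
Proof.
under eq_fun do rewrite pull_time.
by have [] := has_dvM (has_dv_sum (fun j => has_dvX2
  (has_dv_self 0 (differentiable_coord z 0 (rshift n j))))) (has_dv_cst (2 * N%:R)^-1 0 z).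
Qed.

Lemma differentiable_pull z : differentiable pull z.
Proof.
by apply: differentiable_pair; [exact: differentiable_lsubmx | exact: differentiable_time].
Qed.

Lemma diff_pull z v : 'd pull z v = (lsubmx v, 'd (fun w => t w) z v).
Proof.
rewrite diff_pair; [|exact: differentiable_lsubmx | exact: differentiable_time].
by rewrite (@diff_lin _ _ _ (@lsubmx R 1 n N))//; exact: continuous_lsubmx.
Qed.

Lemma has_dv_pull_l (F : P -> R) (i : 'I_n) z : differentiable F (pull z) ->
  has_dv (F \o pull) (delta_mx 0 (lshift N i)) z ('D_(cdir (Some i)) F (pull z)).
Proof.
move=> dF; have dp := differentiable_pull z.
split; first exact: differentiable_comp.
rewrite deriveE; last exact: differentiable_comp.
rewrite diff_comp//= diff_pull [RHS]deriveE//; congr ('d F _ _).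
have [dt] := has_dv_time_l i z; rewrite deriveE// => ->; congr pair.
by apply/matrixP => a b; rewrite !mxE eq_lshift.
Qed.

Lemma has_dv_pull_r (F : P -> R) (j : 'I_N) z : differentiable F (pull z) ->
  has_dv (F \o pull) (delta_mx 0 (rshift n j)) z
    (y z j / N%:R * 'D_(cdir None) F (pull z)).
Proof.
move=> dF; have dp := differentiable_pull z.
split; first exact: differentiable_comp.
rewrite deriveE; last exact: differentiable_comp.
rewrite diff_comp//= diff_pull [in RHS]deriveE//.
have [dt] := has_dv_time_r j z; rewrite deriveE// => ->.
have -> : (lsubmx (delta_mx 0 (rshift n j)) : 'rV[R]_n, y z j / N%:R)
    = (y z j / N%:R) *: (cdir None : P).
  apply/pair_equal_spec; split; last by rewrite /cdir /= /GRing.scale/= mulr1.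
  by apply/matrixP => a b; rewrite !mxE eq_lrshift andbF /cdir/= mulr0.
by rewrite linearZ.
Qed.

Hypothesis N0 : (0 < N)%N.

Let N_neq0 : N%:R != 0 :> R. Proof. by rewrite pnatr_eq0 -lt0n. Qed.

Lemma sum_sqr_pull z : \sum_j y z j ^+ 2 = 2 * N%:R * t z.
Proof. by rewrite pull_time mulrC divfK// mulf_neq0. Qed.

(** Continuity of [pull] makes t > 0 an open condition on z, so identities valid off y = 0 may be
    differentiated there. *)
Lemma near_pull_pos (g h : E -> R) z : U (pull z) ->
  (forall w, U (pull w) -> g w = h w) -> {near z, g =1 h}.
Proof.
move=> z0 gh; have := differentiable_continuous (differentiable_pull z).
move=> /(_ _ (pos_time_nbhs z0)) H.
by apply: (@filterS _ (nbhs z) _ (pull @^-1` U)) H => w; exact: gh.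
Qed.

Lemma pd_eq (g h : E -> R) i z : U (pull z) ->
  (forall w, U (pull w) -> g w = h w) -> pd i g z = pd i h z.
Proof. by move=> z0 gh; apply: near_eq_derive; exact: near_pull_pos. Qed.

Lemma pd2_eq (g h : E -> R) i j z : U (pull z) ->
  (forall w, U (pull w) -> g w = h w) -> pd i (pd j g) z = pd i (pd j h) z.
Proof. by move=> z0 gh; apply: pd_eq => // w w0; exact: pd_eq. Qed.

Lemma lap_eq (g h : E -> R) z : U (pull z) ->
  (forall w, U (pull w) -> g w = h w) -> lap g z = lap h z.
Proof. by move=> z0 gh; apply: eq_bigr => i _; exact: pd2_eq. Qed.

Lemma gradsq_eq (g h : E -> R) z : U (pull z) ->
  (forall w, U (pull w) -> g w = h w) -> gradsq g z = gradsq h z.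
Proof. by move=> z0 gh; apply: eq_bigr => i _; congr (_ ^+ 2); exact: pd_eq. Qed.

Lemma hess_eq (g h : E -> R) z : U (pull z) ->
  (forall w, U (pull w) -> g w = h w) -> hess g z = hess h z.
Proof. by move=> z0 gh; apply/matrixP => i j; rewrite [LHS]mxE [RHS]mxE; exact: pd2_eq. Qed.

Section Derivatives.
Variables (S : set P) (F : nat -> P -> R) (k : nat) (gF : good S F).
Local Notation D o G := ('D_(cdir o) G).

Lemma pd_pull_l i z : U (pull z) ->
  pd (lshift N i) (F k \o pull) z = D (Some i) (F k) (pull z).
Proof. by move=> z0; have [] := has_dv_pull_l i (good_diff k gF z0). Qed.

Lemma pd_pull_r j z : U (pull z) ->
  pd (rshift n j) (F k \o pull) z = y z j / N%:R * D None (F k) (pull z).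
Proof. by move=> z0; have [] := has_dv_pull_r j (good_diff k gF z0). Qed.

Lemma gradsq_pull z : U (pull z) -> gradsq (F k \o pull) z =
  \sum_i D (Some i) (F k) (pull z) ^+ 2
  + 2 * t z / N%:R * D None (F k) (pull z) ^+ 2.
Proof.
move=> z0.
have eA : \sum_(i < n) pd (lshift N i) (F k \o pull) z ^+ 2 =
    \sum_i D (Some i) (F k) (pull z) ^+ 2.
  by apply: eq_bigr => i _; congr (_ ^+ 2); exact: pd_pull_l.
have eB : \sum_(j < N) pd (rshift n j) (F k \o pull) z ^+ 2 =
    2 * t z / N%:R * D None (F k) (pull z) ^+ 2.
  transitivity (\sum_j y z j ^+ 2 * (D None (F k) (pull z) ^+ 2 / N%:R ^+ 2)).
    by apply: eq_bigr => j _; rewrite (pd_pull_r j z0); field.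
  by rewrite -mulr_suml sum_sqr_pull; field.
by rewrite -eA -eB; exact: big_split_ord.
Qed.

Lemma pd_pull_ll i i' z : U (pull z) ->
  pd (lshift N i) (pd (lshift N i') (F k \o pull)) z
  = D (Some i) (D (Some i') (F k)) (pull z).
Proof.
move=> z0; transitivity (pd (lshift N i) (D (Some i') (F k) \o pull) z).
  by apply: pd_eq z0 _ => w; exact: pd_pull_l.
exact: (has_dv_pull_l i (good_diff k (good_D (Some i') gF) z0)).2.
Qed.

Lemma pd_pull_rl i j z : U (pull z) ->
  pd (rshift n j) (pd (lshift N i) (F k \o pull)) z
  = y z j / N%:R * D None (D (Some i) (F k)) (pull z).
Proof.
move=> z0; transitivity (pd (rshift n j) (D (Some i) (F k) \o pull) z).
  by apply: pd_eq z0 _ => w; exact: pd_pull_l.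
exact: (has_dv_pull_r j (good_diff k (good_D (Some i) gF) z0)).2.
Qed.

Lemma pd_pull_lr i j z : U (pull z) ->
  pd (lshift N i) (pd (rshift n j) (F k \o pull)) z
  = y z j / N%:R * D (Some i) (D None (F k)) (pull z).
Proof.
move=> z0.
transitivity (pd (lshift N i) (fun w => y w j * N%:R^-1 * (D None (F k) \o pull) w) z).
  by apply: pd_eq z0 _ => w; exact: pd_pull_r.
have [_] := has_dvM (has_dvM (has_dv_coord (lshift N i) (rshift n j) z)
  (has_dv_cst N%:R^-1 _ _)) (has_dv_pull_l i (good_diff k (good_D None gF) z0)).
by rewrite /pd => ->; rewrite eq_rlshift !mul0r mulr0 !add0r mul0r add0r.
Qed.

Lemma pd_pull_rr j j' z : U (pull z) ->
  pd (rshift n j) (pd (rshift n j') (F k \o pull)) z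
  = (j' == j)%:R / N%:R * D None (F k) (pull z)
    + y z j' * y z j / N%:R ^+ 2 * D None (D None (F k)) (pull z).
Proof.
move=> z0.
transitivity (pd (rshift n j) (fun w => y w j' * N%:R^-1 * (D None (F k) \o pull) w) z).
  by apply: pd_eq z0 _ => w; exact: pd_pull_r.
have [_] := has_dvM (has_dvM (has_dv_coord (rshift n j) (rshift n j') z)
  (has_dv_cst N%:R^-1 _ _)) (has_dv_pull_r j (good_diff k (good_D None gF) z0)).
by rewrite /pd => ->; rewrite eq_rshift /=; field.
Qed.

(** Each of the N diagonal entries in y contributes F_t/N, so the normalisation 2N gives F_t the
    coefficient exactly 1; the rank-one part sums to |y|^2/N^2 = 2t/N. *)
Lemma lap_pull z : U (pull z) -> lap (F k \o pull) z =
  lapx (F k) (pull z) + D None (F k) (pull z)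
  + 2 * t z / N%:R * D None (D None (F k)) (pull z).
Proof.
move=> z0.
have eA : \sum_(i < n) pd (lshift N i) (pd (lshift N i) (F k \o pull)) z =
    lapx (F k) (pull z).
  by apply: eq_bigr => i _; exact: pd_pull_ll.
have eB : \sum_(j < N) pd (rshift n j) (pd (rshift n j) (F k \o pull)) z =
    D None (F k) (pull z) + 2 * t z / N%:R * D None (D None (F k)) (pull z).
  transitivity (\sum_(j < N) (D None (F k) (pull z) / N%:R
      + y z j ^+ 2 * (D None (D None (F k)) (pull z) / N%:R ^+ 2))).
    by apply: eq_bigr => j _; rewrite (pd_pull_rr j j z0) eqxx mulr1n; field.
  rewrite big_split; congr (_ + _); first by rewrite sumr_const card_ord -[LHS]mulr_natl; field.
  transitivity ((\sum_j y z j ^+ 2) * (D None (D None (F k)) (pull z) / N%:R ^+ 2)).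
    by rewrite mulr_suml.
  by rewrite sum_sqr_pull; field.
by rewrite -addrA -eA -eB; exact: big_split_ord.
Qed.

(** The term with prefactor N is the delicate one: it stays small only if F_t/N - c is itself
    O(1/N), as will hold for b^2 and its mean Laplacian. *)
Lemma hs2_pull c z : U (pull z) ->
  hs2 (hess (F k \o pull) z - c%:M) =
  \sum_i \sum_i' (D (Some i) (D (Some i') (F k)) (pull z) - c * (i == i')%:R) ^+ 2
  + 2 * t z / N%:R * (\sum_i D (Some i) (D None (F k)) (pull z) ^+ 2
                     + \sum_i D None (D (Some i) (F k)) (pull z) ^+ 2)
  + (N%:R * (D None (F k) (pull z) / N%:R - c) ^+ 2
     + 4 * t z * (D None (F k) (pull z) / N%:R - c)
         * (D None (D None (F k)) (pull z) / N%:R)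
     + 4 * t z ^+ 2 * (D None (D None (F k)) (pull z) / N%:R) ^+ 2).
Proof.
move=> z0; set G := F k \o pull; set M := hess G z - c%:M.
have ell i i' : M (lshift N i) (lshift N i') =
    D (Some i) (D (Some i') (F k)) (pull z) - c * (i == i')%:R.
  by rewrite /M !mxE (pd_pull_ll i i' z0) eq_lshift mulr_natr.
have elr i j : M (lshift N i) (rshift n j) =
    y z j / N%:R * D (Some i) (D None (F k)) (pull z).
  by rewrite /M !mxE (pd_pull_lr i j z0) eq_lrshift subr0.
have erl i j : M (rshift n j) (lshift N i) =
    y z j / N%:R * D None (D (Some i) (F k)) (pull z).
  by rewrite /M !mxE (pd_pull_rl i j z0) eq_rlshift subr0.
have err j j' : M (rshift n j) (rshift n j') = (j' == j)%:R / N%:R * D None (F k) (pull z)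
    + y z j' * y z j / N%:R ^+ 2 * D None (D None (F k)) (pull z) - c * (j' == j)%:R.
  by rewrite /M !mxE (pd_pull_rr j j' z0) eq_rshift eq_sym mulr_natr.
clearbody M.
have -> : hs2 M = \sum_i \sum_i' M (lshift N i) (lshift N i') ^+ 2
    + \sum_i \sum_j M (lshift N i) (rshift n j) ^+ 2
    + (\sum_j \sum_i M (rshift n j) (lshift N i) ^+ 2
    + \sum_j \sum_j' M (rshift n j) (rshift n j') ^+ 2).
  rewrite /hs2 big_split_ord -!big_split; congr (_ + _);
    by apply: eq_bigr => i _; exact: big_split_ord.
have -> : \sum_i \sum_i' M (lshift N i) (lshift N i') ^+ 2
  = \sum_i \sum_i' (D (Some i) (D (Some i') (F k)) (pull z) - c * (i == i')%:R) ^+ 2.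
  by apply: eq_bigr => i _; apply: eq_bigr => i' _; rewrite ell.
have sy d : \sum_(j < N) (y z j / N%:R * d) ^+ 2 = 2 * t z / N%:R * d ^+ 2.
  transitivity (\sum_j y z j ^+ 2 * (d ^+ 2 / N%:R ^+ 2)).
    by apply: eq_bigr => j _; field.
  by rewrite -mulr_suml sum_sqr_pull; field.
have -> : \sum_i \sum_j M (lshift N i) (rshift n j) ^+ 2
  = 2 * t z / N%:R * \sum_i D (Some i) (D None (F k)) (pull z) ^+ 2.
  rewrite mulr_sumr; apply: eq_bigr => i _.
  by rewrite -sy; apply: eq_bigr => j _; rewrite elr.
have -> : \sum_j \sum_i M (rshift n j) (lshift N i) ^+ 2
  = 2 * t z / N%:R * \sum_i D None (D (Some i) (F k)) (pull z) ^+ 2.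
  rewrite mulr_sumr exchange_big/=; apply: eq_bigr => i _.
  by rewrite -sy; apply: eq_bigr => j _; rewrite erl.
rewrite mulrDr [LHS]addrA; congr (_ + _); first by rewrite !addrA.
(* The y-block is a I + (b/N) y y^T, so its squared norm depends on y only through |y|^2 = 2Nt. *)
set a := D None (F k) (pull z) / N%:R - c.
set b := D None (D None (F k)) (pull z) / N%:R.
have -> : \sum_i \sum_j M (rshift n i) (rshift n j) ^+ 2
  = \sum_i \sum_j ((a ^+ 2 + 2 * a * b / N%:R * y z i ^+ 2) * (i == j)%:R
       + b ^+ 2 / N%:R ^+ 2 * (y z i ^+ 2 * y z j ^+ 2)).
  apply: eq_bigr => i _; apply: eq_bigr => j _.
  rewrite err (eq_sym j) /a /b.
  by case: eqP => [->|_]; rewrite ?mulr1n ?mulr0n; field.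
have -> : \sum_i \sum_j ((a ^+ 2 + 2 * a * b / N%:R * y z i ^+ 2) * (i == j)%:R
       + b ^+ 2 / N%:R ^+ 2 * (y z i ^+ 2 * y z j ^+ 2))
  = \sum_i ((a ^+ 2 + 2 * a * b / N%:R * y z i ^+ 2)
       + b ^+ 2 / N%:R ^+ 2 * (2 * N%:R * t z) * y z i ^+ 2).
  apply: eq_bigr => i _; rewrite big_split; congr (_ + _).
    rewrite (bigD1 i)//= eqxx mulr1 big1 ?addr0// => j ij.
    by rewrite eq_sym (negbTE ij) mulr0.
  transitivity (b ^+ 2 / N%:R ^+ 2 * y z i ^+ 2 * \sum_j y z j ^+ 2).
    by rewrite mulr_sumr; apply: eq_bigr => j _; rewrite mulrA.
  by rewrite sum_sqr_pull mulrAC.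
have -> (u v w : R) : \sum_i (u + v * y z i ^+ 2 + w * y z i ^+ 2) =
    N%:R * u + (v + w) * (2 * N%:R * t z).
  rewrite -sum_sqr_pull mulr_sumr.
  transitivity (\sum_(i < N) (u + (v + w) * y z i ^+ 2)).
    by apply: eq_bigr => i _; rewrite mulrDl addrA.
  by rewrite big_split; congr (_ + _); rewrite sumr_const card_ord [RHS]mulr_natl.
by field.
Qed.

End Derivatives.
End Pullback.

Opaque derive.

(* ring and field compare atoms up to conversion, which is very slow on derivatives. *)
Ltac abstract_derivatives :=
  repeat match goal with
  | |- context [@derive ?R ?V ?W ?F ?p ?v] =>
      move: (@derive R V W F p v) => ?
  | |- context [@lapx ?R ?n ?F ?p] => move: (@lapx R n F p) => ?
  | |- context [@bigop.body ?R ?I ?x ?r ?F] => move: (@bigop.body R I x r F) => ?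
  end.

(** * Products with exponentials, and the equation satisfied by f *)

Section SmoothCalculus.
Context {R : realType} {n : nat}.
Local Notation P := ('rV[R]_n * R)%type.
Local Notation U := [set p : P | 0 < p.2].
Local Notation D o G := ('D_(cdir o) G).
Local Notation smooth G := (good set0 (fun _ : nat => G)).
Implicit Types (F G : P -> R) (p : P) (S : set P) (o : option 'I_n).

Lemma smooth_diff F p : smooth F -> U p -> differentiable F p.
Proof. by move=> /(@good_diff _ _ _ _ 0%N); exact. Qed.

Lemma smooth_D o F : smooth F -> smooth (D o F).
Proof. exact: good_D. Qed.

Lemma has_dv_smooth F v p : smooth F -> U p -> has_dv F v p ('D_v F p).
Proof. by move=> sF p0; apply: has_dv_self; exact: smooth_diff. Qed.

Lemma smooth_schwarz F o o' p : smooth F -> U p -> D o (D o' F) p = D o' (D o F) p.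
Proof. by move=> sF; exact: (@good_schwarz _ _ _ _ 0%N _ _ _ sF). Qed.

Lemma lapxE F p : lapx F p = \sum_i D (Some i) (D (Some i) F) p.
Proof. by []. Qed.

Lemma heatopE F p : heatop F p = D None F p - lapx F p.
Proof. by []. Qed.

Lemma lapx_pos_time F G p : U p -> (forall q, U q -> F q = G q) -> lapx F p = lapx G p.
Proof.
move=> p0 FG; rewrite !lapxE; apply: eq_bigr => i _.
by apply: derive_pos_time => // q q0; exact: derive_pos_time.
Qed.

Lemma heatop_pos_time F G p : U p -> (forall q, U q -> F q = G q) ->
  heatop F p = heatop G p.
Proof.
move=> p0 FG; rewrite !heatopE (lapx_pos_time p0 FG); congr (_ - _).
exact: derive_pos_time.
Qed.

Lemma D_cst (c : R) o p : D o (fun _ : P => c) p = 0.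
Proof. by have [_] := has_dv_cst c (cdir o) p. Qed.

Lemma lapx_cst (c : R) p : lapx (fun _ : P => c) p = 0.
Proof.
rewrite lapxE big1// => i _.
by have -> : D (Some i) (fun _ : P => c) = (fun=> 0);
  [apply/funext => q|]; exact: D_cst.
Qed.

Lemma has_dv_time (o : option 'I_n) p :
  has_dv (fun q : P => q.2) (cdir o) p (if o is Some _ then 0 else 1).
Proof.
have ct : continuous (@snd 'rV[R]_n R) by move=> q; exact: cvg_snd.
have dt : differentiable (fun q : P => q.2) p by apply: (@linear_differentiable _ _ _ (@snd 'rV[R]_n R)) => q; exact: ct.
split => //; rewrite deriveE// (@diff_lin _ _ _ (@snd 'rV[R]_n R)) //.
by case: o.
Qed.

Lemma smooth_time : smooth (fun p : P => p.2).
Proof. by apply: good_time => //; exact: bnd_set0. Qed.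

Lemma smooth_exp F : smooth F -> smooth (fun p => expR (F p)).
Proof. by move=> sF; exact: good_exp. Qed.

Lemma smooth_cst (c : R) : smooth (fun _ : P => c).
Proof. exact: good_cst. Qed.

Lemma smoothD F G : smooth F -> smooth G -> smooth (fun p => F p + G p).
Proof. by move=> sF sG; exact: goodD. Qed.

Lemma smoothM F G : smooth F -> smooth G -> smooth (fun p => F p * G p).
Proof. by move=> sF sG; exact: goodM. Qed.

Lemma smooth_ln_time : smooth (fun p : P => ln p.2).
Proof. by apply: good_ln => //; exact: smooth_time. Qed.

Lemma has_dv_ln_time o p : U p ->
  has_dv (fun q : P => ln q.2) (cdir o) p (if o is Some _ then 0 else p.2^-1).
Proof.
move=> p0; have := has_dv_ln p0 (has_dv_time o p).
by case: o => [i|]; rewrite ?mul0r ?mul1r.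
Qed.

(** Freezing the index turns a uniform family into a plain smooth function, to which the pointwise
    rules of this section apply. *)
Lemma good_at S (F : nat -> P -> R) k : good S F -> smooth (F k).
Proof.
move=> gF j; elim: j F gF => [|j IH] F gF.
  by split=> //; [move=> _ p; exact: good_diff gF | exact: bnd_set0].
split=> //; [by move=> _ p; exact: good_diff gF | exact: bnd_set0 |].
by move=> o; apply: (IH (fun k => D o (F k))); exact: good_D.
Qed.

Lemma good_Dp S (F : nat -> P -> R) s : good S F -> good S (fun k => Dp s (F k)).
Proof. by elim: s => [//|o s IH] gF; apply: good_D; exact: IH. Qed.

Lemma smooth_on_smooth F : smooth F -> smooth_on U F.
Proof. by move=> sF s p p0; exact: (good_diff 0 (good_Dp s sF)). Qed.

Lemma D_mul F G o p : smooth F -> smooth G -> U p ->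
  D o (fun q => F q * G q) p = D o F p * G p + F p * D o G p.
Proof.
by move=> sF sG p0; have [_ ->] := has_dvM (has_dv_smooth (cdir o) sF p0)
  (has_dv_smooth (cdir o) sG p0).
Qed.

Lemma D_add F G o p : smooth F -> smooth G -> U p ->
  D o (fun q => F q + G q) p = D o F p + D o G p.
Proof.
by move=> sF sG p0; have [_ ->] := has_dvD (has_dv_smooth (cdir o) sF p0)
  (has_dv_smooth (cdir o) sG p0).
Qed.

Lemma D_scale (c : R) G o p : smooth G -> U p ->
  D o (fun q => c * G q) p = c * D o G p.
Proof.
move=> sG p0; have [_ ->] := has_dvM (has_dv_cst c (cdir o) p)
  (has_dv_smooth (cdir o) sG p0).
by rewrite mul0r add0r.
Qed.

Lemma DD_lin (c d : R) F G o o' p : smooth F -> smooth G -> U p ->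
  D o (D o' (fun q => c * F q + d * G q)) p = c * D o (D o' F) p + d * D o (D o' G) p.
Proof.
move=> sF sG p0.
have L o1 (A B : P -> R) q : smooth A -> smooth B -> U q ->
   D o1 (fun q => c * A q + d * B q) q = c * D o1 A q + d * D o1 B q.
  move=> sA sB q0.
  apply: (etrans (D_add o1 (smoothM (smooth_cst c) sA) (smoothM (smooth_cst d) sB) q0)).
  by congr (_ + _); exact: D_scale.
transitivity (D o (fun q => c * D o' F q + d * D o' G q) p).
  by apply: derive_pos_time => // q q0; exact: L.
by apply: L => //; exact: smooth_D.
Qed.

Lemma D_exp F o p : smooth F -> U p ->
  D o (fun q => expR (F q)) p = D o F p * expR (F p).
Proof.
by move=> sF p0; have [_ ->] := has_dv_exp (has_dv_smooth (cdir o) sF p0).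
Qed.

Lemma D_mul_exp F g o p : smooth F -> smooth g -> U p ->
  D o (fun q => F q * expR (g q)) p = (D o F p + F p * D o g p) * expR (g p).
Proof.
move=> sF sg p0; apply: (etrans (D_mul o sF (smooth_exp sg) p0)).
by rewrite (D_exp o sg p0); abstract_derivatives; ring.
Qed.

Lemma DD_mul_exp F g o p : smooth F -> smooth g -> U p ->
  D o (D o (fun q => F q * expR (g q))) p =
  (D o (D o F) p + 2 * D o F p * D o g p
   + F p * (D o (D o g) p + D o g p ^+ 2)) * expR (g p).
Proof.
move=> sF sg p0.
transitivity (D o (fun q => (D o F q + F q * D o g q) * expR (g q)) p).
  by apply: derive_pos_time => // q q0; exact: D_mul_exp.
have sFg := smoothM sF (smooth_D o sg).
apply: (etrans (D_mul_exp o (smoothD (smooth_D o sF) sFg) sg p0)).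
congr (_ * _); transitivity
  (D o (D o F) p + (D o F p * D o g p + F p * D o (D o g) p)
   + (D o F p + F p * D o g p) * D o g p).
  congr (_ + _); apply: (etrans (D_add o (smooth_D o sF) sFg p0)).
  by congr (_ + _); exact: D_mul sF (smooth_D o sg) p0.
by abstract_derivatives; ring.
Qed.

Lemma sum_product_rule m (a b c d : 'I_m -> R) (x e : R) :
  \sum_i (a i + 2 * b i * c i + x * (d i + c i ^+ 2)) * e =
  (\sum_i a i + 2 * (\sum_i b i * c i) + x * (\sum_i d i + \sum_i c i ^+ 2)) * e.
Proof.
rewrite -mulr_suml; congr (_ * _); rewrite !big_split/= -!mulr_sumr big_split/=.
by congr (_ + _ + _); rewrite mulr_sumr; apply: eq_bigr => i _; rewrite mulrA.
Qed.

Lemma lapx_mul_exp F g p : smooth F -> smooth g -> U p ->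
  lapx (fun q => F q * expR (g q)) p =
  (lapx F p + 2 * (\sum_i D (Some i) F p * D (Some i) g p)
   + F p * (lapx g p + \sum_i D (Some i) g p ^+ 2)) * expR (g p).
Proof.
move=> sF sg p0; rewrite !lapxE.
transitivity (\sum_i (D (Some i) (D (Some i) F) p + 2 * D (Some i) F p * D (Some i) g p
   + F p * (D (Some i) (D (Some i) g) p + D (Some i) g p ^+ 2)) * expR (g p)).
  by apply: eq_bigr => i _; exact: (DD_mul_exp (Some i) sF sg p0).
exact: sum_product_rule.
Qed.

Section HeatLogarithm.
Variables (u f : P -> R).
Hypotheses (su : smooth_on U u) (u0 : forall p, U p -> 0 < u p)
  (heat : forall p, U p -> 'D_tdir u p = lapx u p)
  (uf : forall p, U p -> u p = p.2 `^ (- (n%:R / 2)) * expR (- f p)).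

(** This is log u on t > 0, written as a linear combination with explicit coefficients so that the
    rules for constant multiples apply. *)
Let g (p : P) : R := -1 * f p + (- (n%:R / 2)) * ln p.2.

Let uE p : U p -> u p = expR (g p).
Proof.
move=> p0; rewrite uf// /g mulN1r expRD mulrC; congr (_ * _).
by rewrite /powR gt_eqF.
Qed.

(** Smoothness is assumed of u; it reaches f through f = -ln u - (n/2) ln t. *)
Lemma log_smooth : smooth f.
Proof.
have smu : smooth u by apply: good_smooth => // s; exact: bnd_set0.
apply: (@good_eq _ _ _ _ (fun _ p => -1 * ln (u p) + (- (n%:R / 2)) * ln p.2)) => //.
  by move=> k p p0; rewrite uE// expRK /g; ring.
by apply: goodD => //; apply: goodM => //; [exact: good_cst | exact: good_ln |
  exact: good_cst | exact: smooth_ln_time].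
Qed.

Let sg : smooth g.
Proof.
by apply: smoothD; apply: smoothM; [exact: smooth_cst | exact: log_smooth |
  exact: smooth_cst | exact: smooth_ln_time].
Qed.

Let Dg o p : U p -> D o g p = - D o f p + (if o is Some _ then 0 else - (n%:R / 2) / p.2).
Proof.
move=> p0; have sf := log_smooth.
apply: (etrans (D_add o (smoothM (smooth_cst (-1)) sf) (smoothM (smooth_cst _) smooth_ln_time) p0)).
congr (_ + _); first by apply: (etrans (D_scale _ _ sf p0)); rewrite mulN1r.
apply: (etrans (D_scale _ _ smooth_ln_time p0)).
by have [_ ->] := has_dv_ln_time o p0; case: (o) => [i|]; rewrite ?mulr0.
Qed.

Let lapx_g p : U p -> lapx g p = - lapx f p.
Proof.
move=> p0; rewrite !lapxE -sumrN; apply: eq_bigr => i _.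
transitivity (D (Some i) (fun q => -1 * D (Some i) f q) p).
  by apply: derive_pos_time => // q q0; rewrite Dg// addr0 mulN1r.
by apply: (etrans (D_scale _ _ (smooth_D _ log_smooth) p0)); rewrite mulN1r.
Qed.

Lemma log_conjugate_heat F p : smooth F -> U p ->
  heatop (fun q => F q * u q) p / u p =
  D None F p + F p * D None g p - lapx F p - 2 * (\sum_i D (Some i) F p * D (Some i) g p)
  - F p * (lapx g p + \sum_i D (Some i) g p ^+ 2).
Proof.
move=> sF p0; have eFu q : U q -> F q * u q = F q * expR (g q) by move=> q0; rewrite uE.
rewrite (heatop_pos_time p0 eFu).
rewrite heatopE (lapx_mul_exp sF sg p0).
have -> : D None (fun q => F q * expR (g q)) p = (D None F p + F p * D None g p) * expR (g p).
  exact: D_mul_exp.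
rewrite uE// -mulrBl mulfK; last by rewrite gt_eqF// expR_gt0.
by abstract_derivatives; ring.
Qed.

(** Conjugation applied to F = 1: the left side is the heat operator of u, which vanishes, and only
    the zeroth-order term remains. *)
Lemma heat_g p : U p -> D None g p = lapx g p + \sum_i D (Some i) g p ^+ 2.
Proof.
move=> p0; have := log_conjugate_heat (smooth_cst 1) p0.
have -> : heatop (fun q => 1 * u q) p = 0.
  rewrite heatopE; have -> : (fun q => 1 * u q) = u by apply/funext => q; rewrite mul1r.
  by rewrite -heat// subrr.
rewrite D_cst lapx_cst mul0r big1 => [|i _]; last by rewrite D_cst mul0r.
by rewrite mulr0 !subr0 add0r !mul1r => /esym/subr0_eq.
Qed.

(** The term n/(2t) is the t-derivative of the normalising factor t^(-n/2). *)
Lemma log_heat p : U p ->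
  D None f p = lapx f p - (\sum_i D (Some i) f p ^+ 2) - n%:R / (2 * p.2).
Proof.
move=> p0; have := heat_g p0; rewrite Dg// lapx_g//.
under eq_bigr do rewrite Dg// addr0 sqrrN.
set A := \sum_i _ => E.
move: E; rewrite invfM; move: A (D None f p) (lapx f p) => A a b E.
have -> : a = - (- a + - (n%:R / 2) / p.2) - n%:R / 2 / p.2 by ring.
by rewrite E; ring.
Qed.

Lemma heatop_mul_u F p : smooth F -> U p ->
  heatop (fun q => F q * u q) p / u p =
  - (lapx F p - D None F p - 2 * \sum_i D (Some i) F p * D (Some i) f p).
Proof.
move=> sF p0; rewrite log_conjugate_heat// heat_g//.
under [X in 2 * X]eq_bigr do rewrite Dg// addr0 mulrN.
by rewrite sumrN; abstract_derivatives; ring.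
Qed.

End HeatLogarithm.

End SmoothCalculus.

(** * The Bochner identity for the parabolic deficit *)

Section Bochner.
Context {R : realType} {n : nat}.
Local Notation P := ('rV[R]_n * R)%type.
Local Notation U := [set p : P | 0 < p.2].
Local Notation D o G := ('D_(cdir o) G).
Local Notation smooth G := (good set0 (fun _ : nat => G)).
Variables (f : P -> R).
Implicit Types (p : P) (o : option 'I_n).

(** The deficit with the t-derivative of t f expanded by the product rule, hence equal to [D0]
    wherever f is differentiable. *)
Definition D0log p := p.2 * (\sum_i D (Some i) f p ^+ 2 + 2 * D None f p) + f p.

(* Minus the heat operator conjugated by u, see heatop_mul_u. *)
Definition backward_drift (F : P -> R) p :=
  lapx F p - D None F p - 2 * \sum_i D (Some i) F p * D (Some i) f p.

Hypothesis sf : smooth f.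

Lemma D0_D0log p : U p -> D0 f p = D0log p.
Proof.
move=> p0; rewrite /D0 /D0log.
have -> : 'D_tdir (fun q : P => q.2 * f q) p = 1 * f p + p.2 * D None f p.
  by have [_] := has_dvM (has_dv_time None p) (has_dv_smooth (cdir None) sf p0).
have -> : 'D_tdir f p = D None f p by [].
have -> : \sum_(i < n) 'D_(xdir i) f p ^+ 2 = \sum_i D (Some i) f p ^+ 2 by [].
by abstract_derivatives; ring.
Qed.

Hypothesis hf : forall p, U p ->
  D None f p = lapx f p - (\sum_i D (Some i) f p ^+ 2) - n%:R / (2 * p.2).

Lemma D_D0log o p : U p -> D o D0log p =
  (if o is Some _ then 0 else 1) * (\sum_i D (Some i) f p ^+ 2 + 2 * D None f p)
  + p.2 * (2 * (\sum_i D (Some i) f p * D o (D (Some i) f) p) + 2 * D o (D None f) p)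
  + D o f p.
Proof.
move=> p0.
have [_] := has_dvD (has_dvM (has_dv_time o p) (has_dvD
  (has_dv_sum (fun i => has_dvX2 (has_dv_smooth (cdir o) (smooth_D (Some i) sf) p0)))
  (has_dvM (has_dv_cst 2 (cdir o) p) (has_dv_smooth (cdir o) (smooth_D None sf) p0))))
  (has_dv_smooth (cdir o) sf p0).
move=> E; apply: (etrans E); congr (_ + _ * (_ + _) + _).
  by rewrite mulr_sumr; apply: eq_bigr => i _; rewrite mulrA.
by rewrite mul0r add0r.
Qed.

(** Exchanging the two sums gathers the third derivatives belonging to each [k] into a single
    Laplacian. *)
Lemma sum_second_derivatives m (t : R) (a c : 'I_m -> 'I_m -> R) (b d e : 'I_m -> R) :
  \sum_i (t * (2 * (\sum_k (a i k + b k * c i k)) + 2 * d i) + e i) =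
  t * (2 * (\sum_i \sum_k a i k) + 2 * (\sum_k b k * \sum_i c i k) + 2 * \sum_i d i)
  + \sum_i e i.
Proof.
rewrite big_split/= -mulr_sumr; congr (_ * _ + _).
rewrite big_split/= -!mulr_sumr; congr (_ + _).
rewrite -mulrDr; congr (_ * _).
transitivity (\sum_i (\sum_k a i k + \sum_k b k * c i k)).
  by apply: eq_bigr => i _; rewrite big_split.
rewrite big_split/=; congr (_ + _).
by rewrite exchange_big/=; apply: eq_bigr => k _; rewrite mulr_sumr.
Qed.

Lemma lapx_D0log p : U p -> lapx D0log p =
  p.2 * (2 * (\sum_i \sum_k D (Some i) (D (Some k) f) p ^+ 2)
   + 2 * (\sum_k D (Some k) f p * lapx (D (Some k) f) p)
   + 2 * lapx (D None f) p) + lapx f p.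
Proof.
move=> p0; rewrite lapxE.
transitivity (\sum_i (p.2 * (2 * (\sum_k (D (Some i) (D (Some k) f) p ^+ 2
   + D (Some k) f p * D (Some i) (D (Some i) (D (Some k) f)) p))
   + 2 * D (Some i) (D (Some i) (D None f)) p) + D (Some i) (D (Some i) f) p)).
  apply: eq_bigr => i _.
  transitivity (D (Some i) (fun q : P => q.2 * (2 * (\sum_k D (Some k) f q *
     D (Some i) (D (Some k) f) q) + 2 * D (Some i) (D None f) q) + D (Some i) f q) p).
    by apply: (@derive_pos_time _ _ _ _ _ _ p0) => q q0; rewrite (D_D0log (Some i) q0) mul0r add0r.
  have h (F : P -> R) : smooth F -> has_dv F (cdir (Some i)) p (D (Some i) F p).
    by move=> sF; exact: has_dv_smooth.
  have [_] := has_dvD (has_dvM (has_dv_time (Some i) p) (has_dvD (has_dvM (has_dv_cst 2 (cdir (Some i)) p)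
   (has_dv_sum (fun k => has_dvM (h _ (smooth_D (Some k) sf))
      (h _ (smooth_D (Some i) (smooth_D (Some k) sf))))))
    (has_dvM (has_dv_cst 2 (cdir (Some i)) p) (h _ (smooth_D (Some i) (smooth_D None sf))))))
    (h _ (smooth_D (Some i) sf)).
  move=> E; apply: (etrans E); rewrite !mul0r !add0r; congr (_ * (_ * _ + _) + _).
exact: (sum_second_derivatives p.2 (fun i k => D (Some i) (D (Some k) f) p ^+ 2)
  (fun i k => D (Some i) (D (Some i) (D (Some k) f)) p) (fun k => D (Some k) f p)
  (fun i => D (Some i) (D (Some i) (D None f)) p) (fun i => D (Some i) (D (Some i) f) p)).
Qed.

Lemma lapx_D o p : U p -> lapx (D o f) p = D o (lapx f) p.
Proof.
move=> p0.
have -> : D o (lapx f) p = \sum_i D o (D (Some i) (D (Some i) f)) p.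
  by have [_] := has_dv_sum (fun i =>
    has_dv_smooth (cdir o) (smooth_D (Some i) (smooth_D (Some i) sf)) p0).
rewrite lapxE; apply: eq_bigr => i _.
transitivity (D (Some i) (D o (D (Some i) f)) p).
  apply: (@derive_pos_time _ _ _ _ _ _ p0) => q q0.
  exact: (smooth_schwarz (Some i) o sf q0).
exact: (smooth_schwarz (Some i) o (smooth_D (Some i) sf) p0).
Qed.

(** Differentiating the equation of f, solved for lap f, trades third derivatives for second ones.
    Only the t-direction sees the term n/(2t). *)
Lemma lapx_D_heat o p : U p -> lapx (D o f) p =
  D o (D None f) p + 2 * (\sum_i D (Some i) f p * D o (D (Some i) f) p)
  - (if o is Some _ then 0 else n%:R / (2 * p.2 ^+ 2)).
Proof.
move=> p0; rewrite lapx_D//.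
transitivity (D o (fun q : P => D None f q + \sum_i D (Some i) f q ^+ 2 + n%:R / 2 * q.2^-1) p).
  apply: (@derive_pos_time _ _ _ _ _ _ p0) => q q0; rewrite (hf q0) invfM.
  by abstract_derivatives; ring.
have [_] := has_dvD (has_dvD (has_dv_smooth (cdir o) (smooth_D None sf) p0)
  (has_dv_sum (fun i => has_dvX2 (has_dv_smooth (cdir o) (smooth_D (Some i) sf) p0))))
  (has_dvM (has_dv_cst (n%:R / 2) (cdir o) p) (has_dvV (lt0r_neq0 p0) (has_dv_time o p))).
move=> E; apply: (etrans E); rewrite mul0r add0r -[RHS]addrA -[LHS]addrA; congr (_ + (_ + _)).
  by rewrite mulr_sumr; apply: eq_bigr => i _; rewrite mulrA.
have p_neq0 : p.2 != 0 by exact: lt0r_neq0.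
by move: (p.2) p_neq0 => t t0; case: (o) => [i|]; field.
Qed.

(** With third derivatives eliminated, the contractions f_i f_it ([s]) and f_i f_k f_ik ([c]) and
    the term f_tt cancel. What is left, 2t |Hess f|^2 - 2 lap f + n/(2t), is a completed square. *)
Theorem bochner_D0 p : U p -> backward_drift D0log p =
  2 * p.2 * (\sum_i \sum_k (D (Some i) (D (Some k) f) p - (i == k)%:R / (2 * p.2)) ^+ 2).
Proof.
move=> p0; have p_neq0 : p.2 != 0 by exact: lt0r_neq0.
have -> : \sum_i \sum_k (D (Some i) (D (Some k) f) p - (i == k)%:R / (2 * p.2)) ^+ 2
  = \sum_i \sum_k D (Some i) (D (Some k) f) p ^+ 2 - lapx f p / p.2
    + n%:R / (4 * p.2 ^+ 2).
  have sq (a b t : R) : t != 0 ->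
      (a - 1 / (2 * t)) ^+ 2 + b = a ^+ 2 + b + (- a / t + (4 * t ^+ 2)^-1).
    by move=> t0; field.
  transitivity (\sum_(i < n) (\sum_k D (Some i) (D (Some k) f) p ^+ 2
     + (- D (Some i) (D (Some i) f) p / p.2 + (4 * p.2 ^+ 2)^-1))).
    (* The shift by 1/(2t) affects only the entry [k = i]. *)
    apply: eq_bigr => i _; rewrite (bigD1 i)//= [in RHS](bigD1 i)//= eqxx.
    have -> : \sum_(k < n | k != i)
       (D (Some i) (D (Some k) f) p - (i == k)%:R / (2 * p.2)) ^+ 2 =
       \sum_(k < n | k != i) D (Some i) (D (Some k) f) p ^+ 2.
      by apply: eq_bigr => k ki; rewrite eq_sym (negbTE ki) mul0r subr0.
    rewrite mulr1n; exact: sq.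
  rewrite big_split/= -[RHS]addrA; congr (_ + _).
  by rewrite big_split/= -mulr_suml sumrN -lapxE sumr_const card_ord -[X in _ + X = _]mulr_natl mulNr.
set A := \sum_i D (Some i) f p ^+ 2.
pose s := \sum_i D (Some i) f p * D (Some i) (D None f) p.
pose c := \sum_i \sum_k D (Some i) f p * (D (Some k) f p * D (Some i) (D (Some k) f) p).
have sE : \sum_i D (Some i) f p * D None (D (Some i) f) p = s.
  by apply: eq_bigr => i _; rewrite (smooth_schwarz None (Some i) sf p0).
have E1 : \sum_k D (Some k) f p * lapx (D (Some k) f) p = s + 2 * c.
  rewrite /s /c mulr_sumr -big_split/=; apply: eq_bigr => i _.
  rewrite (lapx_D_heat (Some i) p0) subr0 -mulr_sumr.
  by abstract_derivatives; ring.
have E2 : lapx (D None f) p = D None (D None f) p + 2 * s - n%:R / (2 * p.2 ^+ 2).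
  by rewrite (lapx_D_heat None p0) sE.
have E3 : \sum_i D (Some i) D0log p * D (Some i) f p = p.2 * (2 * c + 2 * s) + A.
  rewrite mulrDr [p.2 * _]mulrA [p.2 * (2 * s)]mulrA /c /s /A !mulr_sumr -!big_split/=.
  apply: eq_bigr => i _; rewrite (D_D0log (Some i) p0) mul0r add0r -mulr_sumr.
  by abstract_derivatives; ring.
have E4 : D None D0log p = A + 2 * D None f p
    + p.2 * (2 * s + 2 * D None (D None f) p) + D None f p.
  by rewrite (D_D0log None p0) mul1r sE.
have E5 := hf p0; rewrite -/A in E5.
rewrite /backward_drift (lapx_D0log p0) E1 E2 E3 E4 E5.
move: s c A (p.2) p_neq0 {E1 E2 E3 E4 E5 sE} => s c A t t0.
by abstract_derivatives; field.
Qed.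

End Bochner.

(** * Taylor bounds for the exponential and dimensional constants *)

Lemma expR_sub1_le (R : realType) (x : R) : `|expR x - 1| <= `|x| * expR `|x|.
Proof.
have h1 := expR_ge1Dx x.
have h2 : expR x - 1 <= x * expR x.
  (* Multiply 1 - x <= exp(-x) by exp(x). *)
  have := expR_ge1Dx (- x); rewrite expRN => h.
  have e0 := expR_gt0 x.
  have : (1 + - x) * expR x <= 1 by rewrite -ler_pdivlMr// div1r.
  by rewrite mulrDl mul1r mulNr; lra.
have [x0|x0] := lerP 0 x.
  by rewrite !ger0_norm//; lra.
rewrite ltr0_norm; last first.
  by rewrite subr_lt0 expR_lt1.
rewrite (ltr0_norm x0).
have h3 := expR_ge1Dx (- x).
have : - x <= - x * expR (- x) by rewrite ler_peMr; lra.
lra.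
Qed.

Lemma expR_sub1x_le (R : realType) (x : R) :
  `|expR x - 1 - x| <= `|x| ^+ 2 * expR `|x|.
Proof.
have h1 := expR_ge1Dx x.
have h2 : expR x - 1 <= x * expR x.
  have := expR_ge1Dx (- x); rewrite expRN => h.
  have e0 := expR_gt0 x.
  have : (1 + - x) * expR x <= 1 by rewrite -ler_pdivlMr// div1r.
  by rewrite mulrDl mul1r mulNr; lra.
rewrite ger0_norm; last lra.
(* From exp(x) - 1 <= x exp(x) the nonnegative left side is at most x (exp(x) - 1), so the
   first-order bound gains one more factor |x|. *)
apply: (@le_trans _ _ (`|x| * `|expR x - 1|)).
  rewrite -normrM; apply: le_trans (ler_norm _); rewrite mulrBr mulr1; lra.
rewrite expr2 -mulrA; apply: ler_wpM2l => //; exact: expR_sub1_le.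
Qed.

Section DimensionConstants.
Context {R : realType} {n : nat}.

(* Families are indexed by k with N = k + 3, so that m - 2 = n + k + 1 > 0. *)
Definition Ndim (k : nat) : R := k.+3%:R.
Definition mdim (k : nat) : R := (n + k.+3)%:R.
Definition invN k : R := (Ndim k)^-1.
Definition epsm k : R := (n + k.+1)%:R^-1.
(** With this bounded ratio eps = [kap]/N, so every power of eps becomes a power of 1/N with bounded
    coefficient. *)
Definition kap k : R := Ndim k * epsm k.
Definition rhom k : R := Ndim k / mdim k.

Lemma Ndim_gt0 k : 0 < Ndim k. Proof. by rewrite ltr0n. Qed.
Lemma mdim_gt0 k : 0 < mdim k. Proof. by rewrite ltr0n addnS. Qed.
Lemma epsm_gt0 k : 0 < epsm k. Proof. by rewrite invr_gt0 ltr0n addnS. Qed.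
Lemma invN_gt0 k : 0 < invN k. Proof. by rewrite invr_gt0 Ndim_gt0. Qed.

Lemma epsmV k : (epsm k)^-1 = Ndim k + n%:R - 2.
Proof. by rewrite invrK /Ndim !natrD -!natr1; ring. Qed.

Lemma mdimE k : mdim k = Ndim k + n%:R.
Proof. by rewrite /mdim natrD addrC. Qed.

Lemma epsmE k : epsm k = kap k * invN k.
Proof. by rewrite /kap /invN mulrAC divff ?mul1r// gt_eqF// Ndim_gt0. Qed.

(** N = k + 3 <= 3 (k + 1) <= 3 (m - 2). *)
Lemma kap_le k : `|kap k| <= 3.
Proof.
rewrite ger0_norm; last by rewrite mulr_ge0// ltW// ?Ndim_gt0 ?epsm_gt0.
rewrite /kap /epsm ler_pdivrMr ?ltr0n ?addnS// -natrM ler_nat.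
by rewrite -addnS; apply: (@leq_trans (3 * k.+1)); [lia | rewrite leq_mul// leq_addl].
Qed.

Lemma invN_le k : `|invN k| <= 1.
Proof.
rewrite ger0_norm; last exact: ltW (invN_gt0 k).
by rewrite /invN invf_le1 ?Ndim_gt0// ler1n.
Qed.

Lemma epsm_le k : `|epsm k| <= 1.
Proof.
rewrite ger0_norm; last exact: ltW (epsm_gt0 k).
by rewrite /epsm invf_le1 ?ltr0n ?ler1n ?addnS.
Qed.

Lemma rhom_le k : `|rhom k| <= 1.
Proof.
rewrite ger0_norm; last by rewrite divr_ge0// ltW// ?Ndim_gt0 ?mdim_gt0.
by rewrite /rhom ler_pdivrMr ?mdim_gt0// mul1r mdimE lerDl.
Qed.

End DimensionConstants.

Arguments mdim {R} n k.
Arguments epsm {R} n k.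
Arguments kap {R} n k.
Arguments rhom {R} n k.

(** * Taylor quotients of exp(c eps f) *)

Section ExponentialExpansion.
Context {R : realType} {n : nat}.
Local Notation P := ('rV[R]_n * R)%type.
Local Notation U := [set p : P | 0 < p.2].
Local Notation D o G := ('D_(cdir o) G).
Local Notation smooth G := (good set0 (fun _ : nat => G)).
Variables (S : set P) (f : P -> R).
Hypotheses (SU : S `<=` U) (gf : good S (fun=> f)).
Local Notation ep := (@epsm R n).

Let sf : smooth f. Proof. exact: (good_at 0 gf). Qed.

(** Taylor remainders of exp(c eps f) after one and two terms, divided by eps and eps^2. Keeping
    them as functions makes the later expansions in eps exact. *)
Definition exp1 (c : R) k p := (expR (c * ep k * f p) - 1) / ep k.
Definition exp2 (c : R) k p := (exp1 c k p - c * f p) / ep k.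

Lemma expR_exp1 c k p : expR (c * ep k * f p) = 1 + ep k * exp1 c k p.
Proof. by rewrite /exp1 [ep k * _]mulrC divfK ?gt_eqF ?epsm_gt0// addrC subrK. Qed.

Lemma exp1_exp2 c k p : exp1 c k p = c * f p + ep k * exp2 c k p.
Proof. by rewrite /exp2 [ep k * _]mulrC divfK ?gt_eqF ?epsm_gt0// addrC subrK. Qed.

Lemma good_epsf c : good S (fun k p => c * ep k * f p).
Proof.
apply: goodM => //; apply: (good_coef SU (M := `|c|)) => k.
by rewrite normrM ler_piMr// epsm_le.
Qed.

Lemma smooth_exp1 c k : smooth (exp1 c k).
Proof.
apply: smoothM; last exact: smooth_cst.
by apply: smoothD; [apply: smooth_exp; exact: (good_at k (good_epsf c)) | exact: smooth_cst].
Qed.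

Lemma norm_epsf c k p M : `|f p| <= M -> 0 <= M ->
  `|c * ep k * f p| / ep k <= `|c| * M /\ `|c * ep k * f p| <= `|c| * M.
Proof.
move=> fM M0; have e0 := @epsm_gt0 R n k; have e1 := @epsm_le R n k.
rewrite !normrM (gtr0_norm e0) in e1 *.
split; last first.
  apply: ler_pM => //; first by rewrite mulr_ge0// ltW.
  by rewrite ler_piMr.
by rewrite mulrAC mulfK ?gt_eqF// ler_wpM2l.
Qed.

Lemma bnd_exp1 c : bnd S (exp1 c).
Proof.
have [M0 fM0] := good_bnd gf.
pose M := `|M0|.
have fM p : S p -> `|f p| <= M by move=> /(fM0 0%N)/le_trans; apply; exact: ler_norm.
exists (`|c| * M * expR (`|c| * M)) => k p /fM fMp.
have [h1 h2] := norm_epsf c k fMp (normr_ge0 _).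
have e0 := @epsm_gt0 R n k.
rewrite /exp1 normrM normfV (gtr0_norm e0).
apply: (@le_trans _ _ (`|c * ep k * f p| / ep k * expR (`|c * ep k * f p|))).
  by rewrite [leRHS]mulrAC; apply: ler_wpM2r; [rewrite invr_ge0 ltW | exact: expR_sub1_le].
by apply: ler_pM; rewrite ?expR_ge0 ?divr_ge0 ?(ltW e0)// ler_expR.
Qed.

Lemma bnd_exp2 c : bnd S (exp2 c).
Proof.
have [M0 fM0] := good_bnd gf.
pose M := `|M0|.
have fM p : S p -> `|f p| <= M by move=> /(fM0 0%N)/le_trans; apply; exact: ler_norm.
exists ((`|c| * M) ^+ 2 * expR (`|c| * M)) => k p /fM fMp.
have [h1 h2] := norm_epsf c k fMp (normr_ge0 _).
have e0 := @epsm_gt0 R n k.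
have -> : exp2 c k p = (expR (c * ep k * f p) - 1 - c * ep k * f p) / ep k ^+ 2.
  by rewrite /exp2 /exp1; move: (expR _) => a; move: (f p) => b; field; rewrite gt_eqF.
rewrite normrM normfV normrX (gtr0_norm e0).
apply: (@le_trans _ _ ((`|c * ep k * f p| / ep k) ^+ 2 * expR (`|c * ep k * f p|))).
  rewrite expr_div_n [leRHS]mulrAC; apply: ler_wpM2r; first by rewrite invr_ge0 exprn_ge0 ?ltW.
  exact: expR_sub1x_le.
have h0 : 0 <= `|c * ep k * f p| / ep k by rewrite divr_ge0 ?(ltW e0).
apply: ler_pM; rewrite ?expR_ge0 ?exprn_ge0 ?ler_expR//.
by apply: lerXn2r => //; rewrite nnegrE; exact: le_trans h0 h1.
Qed.

Lemma D_exp1 c k o p : U p -> D o (exp1 c k) p = c * expR (c * ep k * f p) * D o f p.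
Proof.
move=> p0.
have [_] := has_dvM (has_dvB (has_dv_exp (has_dvM (has_dv_cst (c * ep k) (cdir o) p)
  (has_dv_smooth (cdir o) sf p0))) (has_dv_cst 1 (cdir o) p)) (has_dv_cst (ep k)^-1 (cdir o) p).
move=> E; apply: (etrans E); have e0 := @epsm_gt0 R n k.
by move: (D o f p) (expR _) => a b; field; rewrite gt_eqF.
Qed.

(** One derivative cancels the division by eps, so the Taylor bound is needed only for the quotient
    itself. Likewise the derivatives of [exp2] reduce to [exp1]. *)
Lemma good_exp1 c : good S (exp1 c).
Proof.
apply: good_of_D; [|exact: bnd_exp1|].
  by move=> k p; apply: smooth_diff; exact: smooth_exp1.
move=> o; apply: (good_eq SU (F := fun k p => c * expR (c * ep k * f p) * D o f p)).
  by move=> k p p0; rewrite D_exp1.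
apply: goodM => //; last exact: (good_D o gf).
by apply: goodM => //; [exact: good_cst | apply: good_exp => //; exact: good_epsf].
Qed.

Lemma good_exp2 c : good S (exp2 c).
Proof.
apply: good_of_D; [|exact: bnd_exp2|].
  move=> k p; apply: smooth_diff; apply: smoothM; last exact: smooth_cst.
  apply: (good_eq (@sub0set _ _) (F := fun _ p => exp1 c k p + (- c) * f p)).
    by move=> _ q _; rewrite mulNr.
  by apply: smoothD; [exact: smooth_exp1 | apply: smoothM => //; exact: smooth_cst].
move=> o; apply: (good_eq SU (F := fun k p => c * exp1 c k p * D o f p)).
  move=> k p p0.
  have [_] := has_dvM (has_dvB (has_dv_smooth (cdir o) (smooth_exp1 c k) p0)
   (has_dvM (has_dv_cst c (cdir o) p) (has_dv_smooth (cdir o) sf p0)))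
   (has_dv_cst (ep k)^-1 (cdir o) p).
  move=> E; apply: esym; apply: (etrans E); rewrite D_exp1// /exp1.
  have e0 := @epsm_gt0 R n k.
  by move: (D o f p) (expR _) => a b; move: (f p) => d; field; rewrite gt_eqF.
apply: goodM => //; last exact: (good_D o gf).
by apply: goodM => //; [exact: good_cst | exact: good_exp1].
Qed.

End ExponentialExpansion.

(** * Expansion of both sides in 1/N as functions of x and t *)

Section Asymptotics.
Context {R : realType} {n : nat}.
Local Notation P := ('rV[R]_n * R)%type.
Local Notation U := [set p : P | 0 < p.2].
Local Notation D o G := ('D_(cdir o) G).
Local Notation smooth G := (good set0 (fun _ : nat => G)).
Local Notation Nk := (@Ndim R).
Local Notation mk := (@mdim R n).
Local Notation dl := (@invN R).
Local Notation ep := (@epsm R n).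
Local Notation ka := (@kap R n).
Local Notation rh := (@rhom R n).
Variables (tau1 tau2 : R) (f : P -> R).
Hypothesis tau1_gt0 : 0 < tau1.
Local Notation S := [set p : P | tau1 <= p.2 <= tau2].
Hypothesis gf : good S (fun=> f).
Hypothesis hf : forall p, U p ->
  D None f p = lapx f p - (\sum_i D (Some i) f p ^+ 2) - n%:R / (2 * p.2).
Implicit Types (p : P).

Let SU : S `<=` U.
Proof. by move=> p /andP[p1 _]; exact: lt_le_trans p1. Qed.

Let sf : smooth f. Proof. exact: (good_at 0 gf). Qed.

Let good_t : good S (fun _ p => p.2).
Proof.
apply: good_time => //; exists tau2 => _ p /andP[p1 p2].
by rewrite ger0_norm// (le_trans (ltW tau1_gt0)).
Qed.

Let good_tV : good S (fun _ p => p.2^-1).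
Proof.
apply: goodV => // [_ p p0|]; first by rewrite gt_eqF.
exists tau1^-1 => _ p /andP[p1 p2]; have p0 := lt_le_trans tau1_gt0 p1.
by rewrite gtr0_norm ?invr_gt0// lef_pV2.
Qed.

Let good_dl : good S (fun k _ => dl k). Proof. exact: (good_coef SU (@invN_le R)). Qed.
Let good_ep : good S (fun k _ => ep k). Proof. exact: (good_coef SU (@epsm_le R n)). Qed.
Let good_ka : good S (fun k _ => ka k). Proof. exact: (good_coef SU (@kap_le R n)). Qed.
Let good_rh : good S (fun k _ => rh k). Proof. exact: (good_coef SU (@rhom_le R n)). Qed.
Let good_e1 c : good S (exp1 f c). Proof. exact: good_exp1. Qed.
Let good_e2 c : good S (exp2 f c). Proof. exact: good_exp2. Qed.

Let good_cst0 (c : R) : good S (fun _ _ => c). Proof. exact: good_cst. Qed.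

Let good_lapx (F : nat -> P -> R) : good S F -> good S (fun k p => lapx (F k) p).
Proof.
move=> gF; apply: (good_eq SU (F := fun k p => \sum_i D (Some i) (D (Some i) (F k)) p)).
  by move=> k p _; rewrite lapxE.
by apply: (good_sum SU) => i; exact: (good_D (Some i) (good_D (Some i) gF)).
Qed.

Ltac good_tac := first
  [ exact: good_cst0 | exact: gf | exact: good_t | exact: good_tV | exact: good_dl
  | exact: good_ep | exact: good_ka | exact: good_rh | exact: good_e1 | exact: good_e2
  | assumption
  | apply: good_lapx; good_tac
  | apply: good_D; good_tac
  | apply: (goodX SU); good_tac
  | apply: (goodN SU); good_tac
  | apply: (goodD SU); good_tac
  | apply: (goodM SU); good_tac
  | apply: (good_sum SU) => ?; good_tac ].

Let A p := \sum_i D (Some i) f p ^+ 2.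
Let ft := D None f.

(* d0_E is d_0 as a function of (x, t): substituting exp(2 eps f) = 1 + eps exp1
   and exp1 = 2 f + eps exp2 in d0_E_closed and collecting powers of eps. *)
Definition d0_H k p := 2 * ka k * p.2 * A p + 4 * p.2 * ft p
  + 4 * ep k * p.2 ^+ 2 * ft p ^+ 2.
Definition d0_Q k p := exp2 f 2 k p - 2 * (n%:R - 2) * p.2 * A p
  + 4 * p.2 ^+ 2 * ft p ^+ 2.
Definition d0_G k p := 8 * D0log f p
  + 2 * (1 + 2 * ep k) * (d0_Q k p + exp1 f 2 k p * d0_H k p).
Definition d0_E k p := 4 * D0log f p + ep k * d0_G k p.

Let good_A : good S (fun _ => A). Proof. by rewrite /A; good_tac. Qed.
Let good_ft : good S (fun _ => ft). Proof. exact: (good_D None gf). Qed.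
Lemma good_D0log : good S (fun _ => D0log f). Proof. by rewrite /D0log; good_tac. Qed.
Let good_Dl := good_D0log.
Lemma good_d0_H : good S d0_H. Proof. by rewrite /d0_H; good_tac. Qed.
Let good_H := good_d0_H.
Lemma good_d0_Q : good S d0_Q. Proof. by rewrite /d0_Q; good_tac. Qed.
Let good_Q := good_d0_Q.
Lemma good_d0_G : good S d0_G. Proof. by rewrite /d0_G; good_tac. Qed.
Let good_G := good_d0_G.
Lemma good_d0_E : good S d0_E. Proof. by rewrite /d0_E; good_tac. Qed.
Let good_E := good_d0_E.

(** Since m = 1/eps + 2, the prefactor satisfies 2 m eps = 2 (1 + 2 eps), whence the term 8 [D0log]
    in [d0_G]. Since N eps = 1 - (n-2) eps, the gradient term leaves -2 (n-2) t |grad f|^2 in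
    [d0_Q]. *)
Lemma d0_E_closed k p : d0_E k p =
  2 * mk k * (expR (2 * ep k * f p)
    * (2 * Nk k * ep k ^+ 2 * p.2 * A p + (1 + 2 * ep k * p.2 * ft p) ^+ 2) - 1).
Proof.
rewrite expR_exp1 /d0_E /d0_G /d0_Q /d0_H (exp1_exp2 f 2) /D0log -/(A p) -/(ft p).
have e0 := @epsm_gt0 R n k; have eV := @epsmV R n k.
have EN : Nk k = (ep k)^-1 - n%:R + 2 by rewrite eV; ring.
rewrite mdimE /kap EN.
move: (exp2 _ _ _ _) (A p) (ft p) (f p) (p.2) (ep k) e0 => X a b c t e e0.
by field; rewrite gt_eqF.
Qed.

(** log v, with r^2 = 2Nt; [logb] is log b. Their t- and N-dependence is not uniformly bounded in
    general, so they are used only as smooth functions for fixed [k]. *)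
Definition logv k p : R :=
  -1 * f p + (- (ep k)^-1 / 2) * (1 * ln p.2 + 1 * ln (2 * Nk k)).
Definition logb k p : R := ep k * f p + 2^-1 * (1 * ln p.2 + 1 * ln (2 * Nk k)).

Let smooth_lnt (c : R) : smooth (fun p : P => 1 * ln p.2 + 1 * c).
Proof.
apply: smoothD; apply: smoothM; [exact: smooth_cst | exact: smooth_ln_time |
  exact: smooth_cst | exact: smooth_cst].
Qed.

Lemma smooth_logv k : smooth (logv k).
Proof.
apply: smoothD; apply: smoothM; [exact: smooth_cst | exact: sf | exact: smooth_cst | exact: smooth_lnt].
Qed.

Lemma smooth_logb k : smooth (logb k).
Proof.
apply: smoothD; apply: smoothM; [exact: smooth_cst | exact: sf | exact: smooth_cst | exact: smooth_lnt].
Qed.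

Let D_lin_lnt (c d e : R) o p : U p ->
  D o (fun q : P => c * f q + d * (1 * ln q.2 + 1 * e)) p =
  c * D o f p + d * (if o is Some _ then 0 else p.2^-1).
Proof.
move=> p0.
have [_] := has_dvD (has_dvM (has_dv_cst c (cdir o) p) (has_dv_smooth (cdir o) sf p0))
  (has_dvM (has_dv_cst d (cdir o) p) (has_dvD (has_dvM (has_dv_cst 1 (cdir o) p)
   (has_dv_ln_time o p0)) (has_dvM (has_dv_cst 1 (cdir o) p) (has_dv_cst e (cdir o) p)))).
move=> E; apply: (etrans E); move: (D o f p) => a; case: (o) => [i|]; ring.
Qed.

Lemma D_logv k o p : U p -> D o (logv k) p =
  -1 * D o f p + (- (ep k)^-1 / 2) * (if o is Some _ then 0 else p.2^-1).
Proof. exact: D_lin_lnt. Qed.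

Lemma D_logb k o p : U p -> D o (logb k) p =
  ep k * D o f p + 2^-1 * (if o is Some _ then 0 else p.2^-1).
Proof. exact: D_lin_lnt. Qed.

Lemma DD_logv_x k i p : U p -> D (Some i) (D (Some i) (logv k)) p =
  - D (Some i) (D (Some i) f) p.
Proof.
move=> p0; transitivity (D (Some i) (fun q => -1 * D (Some i) f q) p).
  apply: (@derive_pos_time _ _ _ _ _ _ p0) => q q0.
  by rewrite (D_logv k (Some i) q0) mulr0 addr0.
by apply: (etrans (D_scale _ _ (smooth_D _ sf) p0)); rewrite mulN1r.
Qed.

Lemma lapx_logv k p : U p -> lapx (logv k) p = - lapx f p.
Proof.
move=> p0; rewrite !lapxE -sumrN; apply: eq_bigr => i _; exact: DD_logv_x.
Qed.

Lemma DD_logv_t k p : U p -> D None (D None (logv k)) p =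
  - D None ft p + (2 * ep k * p.2 ^+ 2)^-1.
Proof.
move=> p0; have t0 : p.2 != 0 by exact: lt0r_neq0.
transitivity (D None (fun q => -1 * ft q + (- (ep k)^-1 / 2) * q.2^-1) p).
  by apply: (@derive_pos_time _ _ _ _ _ _ p0) => q q0; exact: (D_logv k None q0).
have [_] := has_dvD (has_dvM (has_dv_cst (-1) (cdir None) p)
   (has_dv_smooth (cdir None) (smooth_D None sf) p0))
  (has_dvM (has_dv_cst (- (ep k)^-1 / 2) (cdir None) p) (has_dvV t0 (has_dv_time None p))).
move=> E; apply: (etrans E); have e0 := @epsm_gt0 R n k.
rewrite /ft; move: (D None (D None f) p) (D None f p) (p.2) t0 (ep k) e0 => a b t t0 e e0.
by field; rewrite t0 gt_eqF.
Qed.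

Definition d0_J k p :=
  2 * p.2 * D None (D None (d0_E k)) p - 2 * (n%:R - 2) * D None (d0_E k) p
  - 4 * p.2 * D None (d0_E k) p * ft p
  + d0_E k p * ((n%:R - 2) * n%:R / 2 * p.2^-1 + 2 * (n%:R - 2) * ft p
     + 2 * p.2 * (ft p ^+ 2 - D None ft p)).

Lemma good_d0_J : good S d0_J. Proof. by rewrite /d0_J; good_tac. Qed.
Let good_J := good_d0_J.

(** The t-derivative of log v contains -1/(2 eps t), of size N. Its cross term with (2t/N) F_tt
    gives -2 F_t + O(1/N), which turns the forward F_t of the Laplacian into -F_t. In the
    zeroth-order coefficient the parts of size N cancel, and those of size 1 cancel by the equation
    of f. *)
Lemma conjugate_laplacian k p : U p ->
  lapx (fun q => d0_E k q * expR (logv k q)) p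
  + D None (fun q => d0_E k q * expR (logv k q)) p
  + 2 * p.2 / Nk k * D None (D None (fun q => d0_E k q * expR (logv k q))) p
  = (backward_drift f (d0_E k) p + dl k * d0_J k p) * expR (logv k p).
Proof.
move=> p0; have sE := good_at k good_E; have sv := smooth_logv k.
rewrite (lapx_mul_exp sE sv p0).
have -> : D None (fun q => d0_E k q * expR (logv k q)) p =
  (D None (d0_E k) p + d0_E k p * D None (logv k) p) * expR (logv k p).
  exact: D_mul_exp.
have -> : D None (D None (fun q => d0_E k q * expR (logv k q))) p =
  (D None (D None (d0_E k)) p + 2 * D None (d0_E k) p * D None (logv k) p
   + d0_E k p * (D None (D None (logv k)) p + D None (logv k) p ^+ 2)) * expR (logv k p).
  exact: DD_mul_exp.
rewrite mulrA -!mulrDl; congr (_ * _).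
rewrite lapx_logv// (DD_logv_t k p0) (D_logv k None p0) /backward_drift /d0_J.
have -> : \sum_i D (Some i) (logv k) p ^+ 2 = A p.
  by apply: eq_bigr => i _; rewrite (D_logv k (Some i) p0) mulr0 addr0 mulN1r sqrrN.
have -> : \sum_i D (Some i) (d0_E k) p * D (Some i) (logv k) p =
   - \sum_i D (Some i) (d0_E k) p * D (Some i) f p.
  rewrite -sumrN; apply: eq_bigr => i _.
  by rewrite (D_logv k (Some i) p0) mulr0 addr0 mulN1r mulrN.
have -> : lapx f p = ft p + A p + n%:R / (2 * p.2).
  by rewrite /ft (hf p0) -/(A p); move: (lapx f p) (A p) (_ / _) => a b c; ring.
have t0 : p.2 != 0 by exact: lt0r_neq0.
have e0 : ep k != 0 by rewrite gt_eqF// epsm_gt0.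
have N0 : Nk k != 0 by rewrite gt_eqF// Ndim_gt0.
have EN : (ep k)^-1 = Nk k + n%:R - 2 by exact: epsmV.
have EN' : (2 * ep k * p.2 ^+ 2)^-1 = (Nk k + n%:R - 2) / (2 * p.2 ^+ 2).
  by rewrite -EN; field; rewrite t0.
rewrite EN' EN /invN.
have -> : D None f p = ft p by [].
move: (D None ft p) => ftt; move: (ft p) => b.
move: (p.2) t0 (Nk k) N0 (A p) => t t0 N N0 a; move: (d0_E k p) => E.
by abstract_derivatives; field; rewrite t0.
Qed.

Lemma backward_drift_d0_E k p : U p ->
  backward_drift f (d0_E k) p =
  4 * backward_drift f (D0log f) p + ep k * backward_drift f (d0_G k) p.
Proof.
move=> p0; have sD := good_at 0 good_Dl; have sG := good_at k good_G.
have De o : D o (d0_E k) p = 4 * D o (D0log f) p + ep k * D o (d0_G k) p.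
  apply: (etrans (D_add o (smoothM (smooth_cst 4) sD) (smoothM (smooth_cst (ep k)) sG) p0)).
  by rewrite (D_scale 4 o sD p0) (D_scale (ep k) o sG p0).
rewrite /backward_drift De.
have -> : lapx (d0_E k) p = 4 * lapx (D0log f) p + ep k * lapx (d0_G k) p.
  rewrite !lapxE !mulr_sumr -big_split; apply: eq_bigr => i _.
  exact: (DD_lin 4 (ep k) (Some i) (Some i) sD sG p0).
have -> : \sum_i D (Some i) (d0_E k) p * D (Some i) f p =
  4 * (\sum_i D (Some i) (D0log f) p * D (Some i) f p)
  + ep k * (\sum_i D (Some i) (d0_G k) p * D (Some i) f p).
  rewrite !mulr_sumr -big_split; apply: eq_bigr => i _; rewrite De.
  by rewrite mulrDl !mulrA.
by move: (ep k) => e; abstract_derivatives; ring.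
Qed.

(** Writing eps = [kap]/N puts the correction [d0_G] of the deficit and the conjugation error under
    the same factor 1/N. *)
Definition drift_remainder k p := ka k * backward_drift f (d0_G k) p + d0_J k p.

Lemma good_drift_remainder : good S drift_remainder.
Proof. by rewrite /drift_remainder /backward_drift; good_tac. Qed.

Lemma drift_expansion k p : U p ->
  backward_drift f (d0_E k) p + dl k * d0_J k p =
  4 * backward_drift f (D0log f) p + dl k * drift_remainder k p.
Proof.
move=> p0; rewrite backward_drift_d0_E// /drift_remainder epsmE.
by move: (backward_drift _ _ _) (backward_drift _ _ _) => a b; ring.
Qed.


(* sqb is b^2 as a function of (x, t); the splitting 4 t f + Z/N of its
   correction sqb_Y isolates what contributes to the trace-free Hessian. *)
Definition sqb_Y k p := ka k * (2 * p.2 * exp1 f 2 k p).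
Definition sqb k p := 2 * Nk k * p.2 + 1 * sqb_Y k p.
Definition sqb_Z k p := - (n%:R - 2) * ka k * (4 * p.2 * f p)
  + ka k ^+ 2 * (2 * p.2 * exp2 f 2 k p).
Definition sqb_T k p := rh k * (lapx (sqb_Y k) p + D None (sqb_Y k) p
  + 2 * p.2 * dl k * D None (D None (sqb_Y k)) p - 2 * n%:R).

Lemma good_sqb_Y : good S sqb_Y. Proof. by rewrite /sqb_Y; good_tac. Qed.
Let good_Y := good_sqb_Y.
Lemma good_sqb_Z : good S sqb_Z. Proof. by rewrite /sqb_Z; good_tac. Qed.
Let good_Z := good_sqb_Z.
Lemma good_sqb_T : good S sqb_T. Proof. by rewrite /sqb_T; good_tac. Qed.
Let good_T := good_sqb_T.

Lemma smooth_sqb k : smooth (sqb k).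
Proof.
apply: smoothD; apply: smoothM; [exact: smooth_cst | exact: smooth_time |
  exact: smooth_cst | exact: (good_at k good_Y)].
Qed.

Lemma sqb_closed k p : sqb k p = 2 * Nk k * p.2 * expR (2 * ep k * f p).
Proof.
rewrite expR_exp1 /sqb /sqb_Y /kap; move: (exp1 _ _ _ _) => a.
by move: (p.2) (Nk k) (ep k) => t N e; ring.
Qed.

Lemma sqb_Y_Z k : sqb_Y k = (fun p => 4 * (p.2 * f p) + dl k * sqb_Z k p).
Proof.
apply/funext => p; rewrite /sqb_Y (exp1_exp2 f 2) /sqb_Z epsmE.
(* This is N eps = 1 - (n-2) eps, from 1/eps = N + n - 2. *)
have E : ka k = 1 - (n%:R - 2) * ka k * dl k.
  rewrite -mulrA -epsmE /kap; have := @epsmV R n k; have := @epsm_gt0 R n k.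
  move: (ep k) (Nk k) => e N e0 eV.
  have -> : N = e^-1 - n%:R + 2 by rewrite eV; ring.
  by field; rewrite gt_eqF.
move: E (exp2 _ _ _ _) (f p) (p.2); move: (ka k) (dl k) => kk d E X a t.
apply/eqP; rewrite -subr_eq0.
have -> : kk * (2 * t * (2 * a + kk * d * X)) - (4 * (t * a)
   + d * (- (n%:R - 2) * kk * (4 * t * a) + kk ^+ 2 * (2 * t * X)))
   = 4 * t * a * (kk - (1 - (n%:R - 2) * kk * d)) by ring.
by rewrite -E subrr mulr0.
Qed.

Lemma DD_time o o' p : U p -> D o (D o' (fun q : P => q.2)) p = 0.
Proof.
move=> p0; transitivity (D o (fun _ : P => if o' is Some _ then 0 else 1 : R) p).
  apply: (@derive_pos_time _ _ _ _ _ _ p0) => q q0.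
  by have [_ ->] := has_dv_time o' q.
exact: D_cst.
Qed.

Lemma D_sqb_t k p : U p -> D None (sqb k) p = 2 * Nk k + D None (sqb_Y k) p.
Proof.
move=> p0; have sY := good_at k good_Y.
apply: (etrans (D_add None (smoothM (smooth_cst (2 * Nk k)) smooth_time)
   (smoothM (smooth_cst 1) sY) p0)).
rewrite (D_scale _ _ smooth_time p0) (D_scale _ _ sY p0).
by have [_ ->] := has_dv_time None p; rewrite mulr1 mul1r.
Qed.

Lemma DD_sqb k o o' p : U p -> D o (D o' (sqb k)) p = D o (D o' (sqb_Y k)) p.
Proof.
move=> p0; have sY := good_at k good_Y.
apply: (etrans (DD_lin (2 * Nk k) 1 o o' smooth_time sY p0)).
by rewrite DD_time// mulr0 add0r mul1r.
Qed.

Lemma lapx_sqb k p : U p -> lapx (sqb k) p = lapx (sqb_Y k) p.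
Proof. by move=> p0; rewrite !lapxE; apply: eq_bigr => i _; exact: DD_sqb. Qed.

(** The leading part 2Nt of b^2 has Laplacian 2N, and 2N/m = 2 - 2n/m; this is the origin of -2n in
    [sqb_T]. *)
Lemma mean_laplacian_sqb k p : U p ->
  (lapx (sqb k) p + D None (sqb k) p + 2 * p.2 / Nk k * D None (D None (sqb k)) p)
    / mk k = 2 + dl k * sqb_T k p.
Proof.
move=> p0; rewrite (lapx_sqb k p0) (D_sqb_t k p0) (DD_sqb k None None p0).
rewrite /sqb_T /rhom /invN; have := @mdim_gt0 R n k; rewrite mdimE.
have := @Ndim_gt0 R k; move: (Nk k) (p.2) => N t N0 m0.
by abstract_derivatives; field; rewrite !gt_eqF.
Qed.

Lemma DD_sqb_Y_x k i j p : U p -> D (Some i) (D (Some j) (sqb_Y k)) p =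
  4 * p.2 * D (Some i) (D (Some j) f) p + dl k * D (Some i) (D (Some j) (sqb_Z k)) p.
Proof.
move=> p0; have st := smoothM smooth_time sf.
have Dtf F q l : smooth F -> U q ->
    D (Some l) (fun q : P => q.2 * F q) q = q.2 * D (Some l) F q.
  move=> sF q0; apply: (etrans (D_mul (Some l) smooth_time sF q0)).
  by have [_ ->] := has_dv_time (Some l) q; rewrite mul0r add0r.
have DDtf : D (Some i) (D (Some j) (fun q : P => q.2 * f q)) p =
    p.2 * D (Some i) (D (Some j) f) p.
  transitivity (D (Some i) (fun q : P => q.2 * D (Some j) f q) p).
    by apply: (@derive_pos_time _ _ _ _ _ _ p0) => q q0; exact: (Dtf f q j sf q0).
  exact: (Dtf _ p i (smooth_D (Some j) sf) p0).
rewrite -mulrA -DDtf sqb_Y_Z.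
exact: (DD_lin 4 (dl k) (Some i) (Some j) st (good_at k good_Z) p0).
Qed.

Definition hess_main i j p := 4 * p.2 * D (Some i) (D (Some j) f) p - 2 * (i == j)%:R.
Definition hess_err i j k p :=
  D (Some i) (D (Some j) (sqb_Z k)) p - sqb_T k p * (i == j)%:R.
Definition hess_sum p := \sum_i \sum_j hess_main i j p ^+ 2.
(** N times the excess of |B|^2 over [hess_sum]. The diagonal part of the y-block contributes N
    squares of size 1/N^2, because the Hessian 2I of |y|^2 is removed by the leading trace term; the
    mixed blocks carry the factor 2t/N. *)
Definition hess_r k p :=
  \sum_i \sum_j (2 * hess_main i j p * hess_err i j k p + dl k * hess_err i j k p ^+ 2)
  + 2 * p.2 * (\sum_i D (Some i) (D None (sqb_Y k)) p ^+ 2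
              + \sum_i D None (D (Some i) (sqb_Y k)) p ^+ 2)
  + (D None (sqb_Y k) p - sqb_T k p) ^+ 2
  + 4 * p.2 * dl k * (D None (sqb_Y k) p - sqb_T k p) * D None (D None (sqb_Y k)) p
  + 4 * p.2 ^+ 2 * dl k * D None (D None (sqb_Y k)) p ^+ 2.
(** Chosen so that m/b^2 = (1 + [hess_a]/N)/(2t), by multiplying out m/N = 1 + n/N and exp(-2 eps f)
    = 1 + eps [exp1]. *)
Definition hess_a k p := n%:R + ka k * exp1 f (-2) k p + n%:R * ka k * dl k * exp1 f (-2) k p.
Definition hess_remainder k p := 2^-1 * p.2^-1 *
  (hess_r k p + hess_a k p * hess_sum p + dl k * hess_a k p * hess_r k p).

Let good_main i j : good S (fun _ => hess_main i j).
Proof. by rewrite /hess_main; good_tac. Qed.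
Let good_err i j : good S (hess_err i j).
Proof. by rewrite /hess_err; good_tac. Qed.
Let good_sum_main : good S (fun _ => hess_sum).
Proof.
by apply: (good_sum SU) => i; apply: (good_sum SU) => j; apply: (goodX SU); exact: good_main.
Qed.
Let good_r : good S hess_r.
Proof.
rewrite /hess_r.
apply: (goodD SU); last by good_tac.
apply: (goodD SU); last by good_tac.
apply: (goodD SU); last by good_tac.
apply: (goodD SU); last by good_tac.
apply: (good_sum SU) => i; apply: (good_sum SU) => j.
apply: (goodD SU).
  by apply: (goodM SU); [apply: (goodM SU); [exact: good_cst0 | exact: good_main] | exact: good_err].
by apply: (goodM SU); [exact: good_dl | apply: (goodX SU); exact: good_err].
Qed.
Let good_a : good S hess_a. Proof. by rewrite /hess_a; good_tac. Qed.

Lemma good_hess_remainder : good S hess_remainder.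
Proof.
rewrite /hess_remainder; apply: (goodM SU); first by good_tac.
apply: (goodD SU).
  apply: (goodD SU); first exact: good_r.
  by apply: (goodM SU); [exact: good_a | exact: good_sum_main].
apply: (goodM SU); last exact: good_r.
by apply: (goodM SU); [exact: good_dl | exact: good_a].
Qed.

(** Here the elliptic and parabolic sides meet: 4t Hess f - 2I is 4t times the matrix in the Bochner
    identity, and 16 t^2/(2t) = 4 * 2t. *)
Lemma hess_sum_bochner p : U p ->
  hess_sum p / (2 * p.2) = 4 * backward_drift f (D0log f) p.
Proof.
move=> p0; rewrite (bochner_D0 sf hf p0); have t0 : p.2 != 0 by exact: lt0r_neq0.
have -> : hess_sum p = 16 * p.2 ^+ 2 *
  (\sum_i \sum_k (D (Some i) (D (Some k) f) p - (i == k)%:R / (2 * p.2)) ^+ 2).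
  rewrite /hess_sum mulr_sumr; apply: eq_bigr => i _.
  rewrite mulr_sumr; apply: eq_bigr => j _; rewrite /hess_main.
  by move: (D (Some i) _ p) (p.2) t0 ((i == j)%:R : R) => a t t0 b; field.
by move: (p.2) t0 (\sum_i _) => t t0 b; field; rewrite t0.
Qed.

Lemma hess_algebra (s a r1 b2 b3 y e T t N : R) : t != 0 -> N != 0 ->
  (1 + N^-1 * a) / (2 * t) * (s + N^-1 * r1 + 2 * t / N * (b2 + b3)
    + (N * (N^-1 * (y - T)) ^+ 2 + 4 * t * (N^-1 * (y - T)) * (e / N)
       + 4 * t ^+ 2 * (e / N) ^+ 2))
  = s / (2 * t) + N^-1 * (2^-1 * t^-1 *
     (r1 + 2 * t * (b2 + b3) + (y - T) ^+ 2 + 4 * t * N^-1 * (y - T) * e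
       + 4 * t ^+ 2 * N^-1 * e ^+ 2
      + a * s
      + N^-1 * a * (r1 + 2 * t * (b2 + b3) + (y - T) ^+ 2 + 4 * t * N^-1 * (y - T) * e
       + 4 * t ^+ 2 * N^-1 * e ^+ 2))).
Proof. by move=> t0 N0; field; rewrite t0 N0. Qed.

Lemma hess_expansion k p : U p ->
  mk k / sqb k p *
   (\sum_i \sum_j (D (Some i) (D (Some j) (sqb k)) p - (2 + dl k * sqb_T k p) * (i == j)%:R) ^+ 2
  + 2 * p.2 / Nk k * (\sum_i D (Some i) (D None (sqb k)) p ^+ 2
                     + \sum_i D None (D (Some i) (sqb k)) p ^+ 2)
  + (Nk k * (D None (sqb k) p / Nk k - (2 + dl k * sqb_T k p)) ^+ 2
     + 4 * p.2 * (D None (sqb k) p / Nk k - (2 + dl k * sqb_T k p))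
         * (D None (D None (sqb k)) p / Nk k)
     + 4 * p.2 ^+ 2 * (D None (D None (sqb k)) p / Nk k) ^+ 2))
  = 4 * backward_drift f (D0log f) p + dl k * hess_remainder k p.
Proof.
move=> p0; have t0 : p.2 != 0 by exact: lt0r_neq0.
have N0 : Nk k != 0 by rewrite gt_eqF// Ndim_gt0.
have E1 : \sum_i \sum_j (D (Some i) (D (Some j) (sqb k)) p
    - (2 + dl k * sqb_T k p) * (i == j)%:R) ^+ 2 = hess_sum p + dl k *
    \sum_i \sum_j (2 * hess_main i j p * hess_err i j k p + dl k * hess_err i j k p ^+ 2).
  rewrite /hess_sum mulr_sumr -big_split /=; apply: eq_bigr => i _.
  rewrite mulr_sumr -big_split /=; apply: eq_bigr => j _.
  rewrite (DD_sqb k (Some i) (Some j) p0) (DD_sqb_Y_x k i j p0) /hess_main /hess_err.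
  move: (D (Some i) (D (Some j) f) p) (D (Some i) (D (Some j) (sqb_Z k)) p) ((i == j)%:R : R) => a b c.
  by move: (sqb_T k p) (dl k) (p.2) => T d t; ring.
have E2 : \sum_i D (Some i) (D None (sqb k)) p ^+ 2 =
    \sum_i D (Some i) (D None (sqb_Y k)) p ^+ 2.
  by apply: eq_bigr => i _; rewrite (DD_sqb k (Some i) None p0).
have E3 : \sum_i D None (D (Some i) (sqb k)) p ^+ 2 =
    \sum_i D None (D (Some i) (sqb_Y k)) p ^+ 2.
  by apply: eq_bigr => i _; rewrite (DD_sqb k None (Some i) p0).
have E4 : D None (sqb k) p / Nk k - (2 + dl k * sqb_T k p) =
   dl k * (D None (sqb_Y k) p - sqb_T k p).
  rewrite (D_sqb_t k p0) /invN; move: (D None (sqb_Y k) p) (sqb_T k p) => a b.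
  by move: (Nk k) N0 => N N0; field.
have E5 := DD_sqb k None None p0.
have E6 : mk k / sqb k p = (1 + dl k * hess_a k p) / (2 * p.2).
  rewrite sqb_closed !invfM -expRN.
  have -> : - (2 * ep k * f p) = (-2) * ep k * f p by ring.
  rewrite expR_exp1 epsmE /hess_a mdimE /invN; move: (exp1 _ _ _ _) => F.
  by move: (p.2) t0 (Nk k) N0 (ka k) => t t0 N N0 kk; field; rewrite t0 N0.
have C x x' b1 b1' b2 b2' b3 b3' d d' e e' : x = x' -> b1 = b1' -> b2 = b2' ->
    b3 = b3' -> d = d' -> e = e' ->
  x * (b1 + 2 * p.2 / Nk k * (b2 + b3)
    + (Nk k * d ^+ 2 + 4 * p.2 * d * (e / Nk k) + 4 * p.2 ^+ 2 * (e / Nk k) ^+ 2))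
  = x' * (b1' + 2 * p.2 / Nk k * (b2' + b3')
    + (Nk k * d' ^+ 2 + 4 * p.2 * d' * (e' / Nk k) + 4 * p.2 ^+ 2 * (e' / Nk k) ^+ 2)).
  by do 6!move=> ->.
apply: (etrans (C _ _ _ _ _ _ _ _ _ _ _ _ E6 E1 E2 E3 E4 E5)).
rewrite -(hess_sum_bochner p0) /hess_remainder /hess_r /invN.
exact: hess_algebra.
Qed.

End Asymptotics.

(** * Transfer to v, b, d_0 and B on R^(n+N) *)

Section AmbientSpace.
Context {R : realType} {n : nat}.
Local Notation P := ('rV[R]_n * R)%type.
Local Notation U := [set p : P | 0 < p.2].
Local Notation D o G := ('D_(cdir o) G).
Local Notation Nk := (@Ndim R).
Local Notation ep := (@epsm R n).
Variables (tau1 tau2 : R) (f : P -> R).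
Hypothesis tau1_gt0 : 0 < tau1.
Local Notation S := [set p : P | tau1 <= p.2 <= tau2].
Hypothesis gf : good S (fun=> f).
Hypothesis hf : forall p, U p ->
  D None f p = lapx f p - (\sum_i D (Some i) f p ^+ 2) - n%:R / (2 * p.2).
Variable k : nat.
Implicit Types (w z : 'rV[R]_(n + k.+3)).

Lemma sqnorm_ge0 m (y : 'rV[R]_m) : 0 <= sqnorm y.
Proof. by apply: sumr_ge0 => i _; exact: sqr_ge0. Qed.

Lemma sqr_enorm m (y : 'rV[R]_m) : enorm y ^+ 2 = sqnorm y.
Proof. by rewrite /enorm sqr_sqrtr// sqnorm_ge0. Qed.

Let N2_gt0 : 0 < 2 * Nk k. Proof. by rewrite mulr_gt0// Ndim_gt0. Qed.

Lemma sqnorm_pull w : sqnorm (rsubmx w) = (pull w).2 * (2 * Nk k).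
Proof. by rewrite /pull /= divfK// gt_eqF. Qed.

Lemma two_sub_mdim : 2 - (n + k.+3)%:R = - (ep k)^-1 :> R.
Proof. by rewrite epsmV -[(n + _)%:R]/(mdim n k) mdimE; ring. Qed.

Lemma vfun_pull w : U (pull w) -> vfun n k.+3 f w = expR (logv f k (pull w)).
Proof.
move=> w0; have s0 : 0 < sqnorm (rsubmx w) by rewrite sqnorm_pull mulr_gt0.
have r0 : 0 < enorm (rsubmx w) by rewrite sqrtr_gt0.
have lnr : ln (enorm (rsubmx w)) = 2^-1 * (1 * ln (pull w).2 + 1 * ln (2 * Nk k)).
  have : ln (enorm (rsubmx w) ^+ 2) = 2 * ln (enorm (rsubmx w)).
    by rewrite lnXn// mulr_natl.
  rewrite sqr_enorm sqnorm_pull lnM ?posrE// !mul1r => ->.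
  by rewrite mulrA mulVf ?mul1r.
rewrite /vfun sqr_enorm -[(lsubmx w, _)]/(pull w) two_sub_mdim.
rewrite /powR gt_eqF// -expRD lnr /logv; congr expR.
by move: (f _) (ln _) (ln _) ((ep k)^-1) => a b c d; field.
Qed.

Lemma bfun_pull w : U (pull w) -> bfun n k.+3 f w = expR (logb f k (pull w)).
Proof.
move=> w0; rewrite /bfun vfun_pull// two_sub_mdim /powR gt_eqF ?expR_gt0// expRK.
congr expR; rewrite /logv /logb; have := @epsm_gt0 R n k.
by move: (f _) (ln _) (ln _) (ep k) => a b c d d0; field; rewrite gt_eqF.
Qed.

Lemma sqr_bfun_pull w : U (pull w) -> bfun n k.+3 f w ^+ 2 = sqb f k (pull w).
Proof.
move=> w0; rewrite bfun_pull// sqb_closed expr2 -expRD.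
have -> : logb f k (pull w) + logb f k (pull w) =
    ln (2 * Nk k) + ln (pull w).2 + 2 * ep k * f (pull w).
  by rewrite /logb; move: (f _) (ln _) (ln _) (ep k) => a b c d; field.
by rewrite !expRD !lnK ?posrE.
Qed.

Lemma d0fun_pull w : U (pull w) -> d0fun n k.+3 f w = d0_E f k (pull w).
Proof.
move=> w0; rewrite /d0fun d0_E_closed -[(n + _)%:R]/(mdim n k).
congr (_ * (_ - _)).
have sb := smooth_logb gf k.
rewrite (gradsq_eq w0 bfun_pull).
apply: (etrans (gradsq_pull (ltn0Sn k.+2) 0 (smooth_exp sb) w0)).
(* Differentiating b = exp(log b) gives D b = b D(log b), so every squared derivative carries the
   common factor b^2. *)
have De o : D o (fun p => expR (logb f k p)) (pull w) ^+ 2 =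
   (ep k * D o f (pull w) + 2^-1 * (if o is Some _ then 0 else (pull w).2^-1)) ^+ 2
   * (2 * Nk k * (pull w).2 * expR (2 * ep k * f (pull w))).
  rewrite (D_exp o sb w0) exprMn (D_logb gf k o w0); congr (_ * _).
  by rewrite -sqb_closed -sqr_bfun_pull// bfun_pull.
have E1 : \sum_i D (Some i) (fun p => expR (logb f k p)) (pull w) ^+ 2 =
   ep k ^+ 2 * (\sum_i D (Some i) f (pull w) ^+ 2)
   * (2 * Nk k * (pull w).2 * expR (2 * ep k * f (pull w))).
  rewrite mulr_sumr mulr_suml; apply: eq_bigr => i _.
  by rewrite De mulr0 addr0 exprMn.
apply: (etrans (congr2 (fun a b => a + 2 * (pull w).2 / Nk k * b) E1 (De None))).
have t0 : (pull w).2 != 0 by exact: lt0r_neq0.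
have N0 : Nk k != 0 by rewrite gt_eqF// Ndim_gt0.
move: (expR _) (\sum_i _) (D None f (pull w)) => e A b.
by move: ((pull w).2) t0 (Nk k) N0 (ep k) => t t0 N N0 d; field; rewrite t0 N0.
Qed.


Lemma lap_d0v z : U (pull z) ->
  lap (fun w => d0fun n k.+3 f w * vfun n k.+3 f w) z / vfun n k.+3 f z =
  4 * backward_drift f (D0log f) (pull z) + invN k * drift_remainder f k (pull z).
Proof.
move=> z0; have sE := good_at k (good_d0_E tau1_gt0 gf); have sv := smooth_logv gf k.
rewrite -(drift_expansion tau1_gt0 gf k z0) vfun_pull//.
have E : lap (fun w => d0fun n k.+3 f w * vfun n k.+3 f w) z =
  lap ((fun q => d0_E f k q * expR (logv f k q)) \o pull) z.
  by apply: lap_eq z0 _ => w w0; rewrite d0fun_pull// vfun_pull.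
rewrite E; have -> : lap ((fun q => d0_E f k q * expR (logv f k q)) \o pull) z =
  (backward_drift f (d0_E f k) (pull z) + invN k * d0_J f k (pull z)) * expR (logv f k (pull z)).
  apply: (etrans (lap_pull (ltn0Sn k.+2) 0 (smoothM sE (smooth_exp sv)) z0)).
  exact: (conjugate_laplacian tau1_gt0 gf hf k z0).
have e0 : expR (logv f k (pull z)) != 0 by rewrite gt_eqF ?expR_gt0.
exact: mulfK e0 _.
Qed.

Lemma hs2_Bmat z : U (pull z) ->
  (n + k.+3)%:R / bfun n k.+3 f z ^+ 2 * hs2 (Bmat n k.+3 f z) =
  4 * backward_drift f (D0log f) (pull z) + invN k * hess_remainder f k (pull z).
Proof.
move=> z0; have sW := smooth_sqb tau1_gt0 gf k.
have eW w : U (pull w) -> bfun n k.+3 f w ^+ 2 = (sqb f k \o pull) w.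
  exact: sqr_bfun_pull.
rewrite -(hess_expansion tau1_gt0 gf hf k z0) (sqr_bfun_pull z0).
congr (_ * _); rewrite /Bmat (hess_eq z0 eW) (lap_eq z0 eW).
have -> : lap (sqb f k \o pull) z / (n + k.+3)%:R = 2 + invN k * sqb_T f k (pull z).
  rewrite -(mean_laplacian_sqb tau1_gt0 gf k z0) -[(n + _)%:R]/(mdim n k).
  by congr (_ / _); exact: (lap_pull (ltn0Sn k.+2) 0 sW z0).
exact: (hs2_pull (ltn0Sn k.+2) 0 sW _ z0).
Qed.

End AmbientSpace.

(** * The three estimates *)

Theorem theorem1p1 (R : realType) (n : nat) (u f : 'rV[R]_n * R -> R)
    (tau1 tau2 : R) :
  (1 <= n)%N ->
  smooth_on [set p | 0 < p.2] u ->
  (forall p : 'rV[R]_n * R, 0 < p.2 -> 0 < u p) ->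
  (forall p : 'rV[R]_n * R, 0 < p.2 -> 'D_tdir u p = lapx u p) ->
  (forall p : 'rV[R]_n * R, 0 < p.2 -> u p = p.2 `^ (- (n%:R / 2)) * expR (- f p)) ->
  0 < tau1 -> tau1 < tau2 ->
  (forall s : seq (option 'I_n), exists M : R,
     forall p : 'rV[R]_n * R, tau1 <= p.2 <= tau2 -> `|Dp s f p| <= M) ->
  exists C : R, forall (N : nat) (x : 'rV[R]_n) (y : 'rV[R]_N),
    (3 <= N)%N ->
    let m : R := (n + N)%:R in
    let z : 'rV[R]_(n + N) := row_mx x y in
    let tau : R := enorm y ^+ 2 / (2 * N%:R) in
    let v := vfun n N f in
    let d0 := d0fun n N f in
    tau1 <= tau <= tau2 ->
    [/\ `| lap (fun w => d0 w * v w) z / v z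
           - m / bfun n N f z ^+ 2 * hs2 (Bmat n N f z) | <= C / N%:R,
        `| d0 z - 4 * D0 f (x, tau) | <= C / N%:R
      & `| lap (fun w => d0 w * v w) z / v z
           + 4 * (heatop (fun p => D0 f p * u p) (x, tau) / u (x, tau)) | <= C / N%:R].
Proof.
move=> _ su u0 heat uf t1 t12 bf.
have sf : good set0 (fun=> f) by exact: (log_smooth su u0 uf).
have hf := log_heat su u0 heat uf.
have gf : good [set p | tau1 <= p.2 <= tau2] (fun=> f).
  apply: good_smooth; first exact: smooth_on_smooth.
  by move=> s; have [M fM] := bf s; exists M => _ p; exact: fM.
have sD0 := good_at 0 (good_D0log t1 gf).
have gG : good [set p | tau1 <= p.2 <= tau2] (fun k p => kap n k * d0_G f k p).
  have SU : [set p : 'rV[R]_n * R | tau1 <= p.2 <= tau2] `<=` [set p | 0 < p.2].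
    by move=> p /andP[p1 _]; exact: lt_le_trans p1.
  by apply: (goodM SU); [exact: (good_coef SU (@kap_le R n)) | exact: good_d0_G].
have [M1 b1] := good_bnd gG.
have [M2 b2] := good_bnd (good_drift_remainder t1 gf).
have [M3 b3] := good_bnd (good_hess_remainder t1 gf).
(* The three bounds control the remainders of d_0, of the conjugated Laplacian and of m |B|^2/b^2.
   The estimates use [M2] with [M3], [M1], and [M2] respectively. *)
exists (`|M1| + `|M2| + `|M3|) => N x y N3.
case: N y N3 => [//|[//|[//|k]]] y _ m z tau v d0 tauS.
have pz : pull z = (x, tau) by rewrite /pull /z row_mxKl row_mxKr /tau sqr_enorm.
have S0 : tau1 <= (pull z).2 <= tau2 by rewrite pz.
have z0 : 0 < (pull z).2 by case/andP: S0 => h _; exact: lt_le_trans h.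
have N0 := @invN_gt0 R k.
have bound (a b c : R) : a = invN k * b -> `|b| <= c ->
    c <= `|M1| + `|M2| + `|M3| -> `|a| <= (`|M1| + `|M2| + `|M3|) / k.+3%:R.
  move=> -> bc cM; rewrite normrM (gtr0_norm N0) mulrC.
  by apply: ler_wpM2r; [exact: ltW | exact: le_trans cM].
have n1 : `|M1| <= `|M1| + `|M2| + `|M3| by rewrite -addrA lerDl addr_ge0.
have n23 : `|M2| + `|M3| <= `|M1| + `|M2| + `|M3| by rewrite -addrA lerDr.
have n2 : `|M2| <= `|M1| + `|M2| + `|M3| by apply: le_trans n23; rewrite lerDl.
have c1 := le_trans (b1 k _ S0) (ler_norm M1).
have c2 := le_trans (b2 k _ S0) (ler_norm M2).
have c3 := le_trans (b3 k _ S0) (ler_norm M3).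
have lapE := lap_d0v t1 gf hf z0.
split.
(* Both quantities have the same main term, so their difference is 1/N times a difference of bounded
   remainders. *)
- rewrite /v /d0 lapE /m (hs2_Bmat t1 gf hf z0).
  apply: (bound _ (drift_remainder f k (pull z) - hess_remainder f k (pull z)) _ _ _ n23).
    by move: (backward_drift _ _ _) (drift_remainder _ _ _) (hess_remainder _ _ _) => a b c; ring.
  by apply: le_trans (ler_normB _ _) _; apply: lerD.
- rewrite /d0 (d0fun_pull gf z0) -pz (D0_D0log sf z0).
  apply: (bound _ _ _ _ c1 n1).
  rewrite /d0_E epsmE; move: (D0log _ _) (d0_G _ _ _) => a b; ring.
- rewrite /v /d0 lapE -pz.
  have -> : heatop (fun p => D0 f p * u p) (pull z) =
      heatop (fun p => D0log f p * u p) (pull z).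
    by apply: (heatop_pos_time z0) => q q0; rewrite (D0_D0log sf q0).
  (* The conjugated heat operator is minus the drift operator, so the main terms cancel in the
     sum. *)
  rewrite (heatop_mul_u su u0 heat uf sD0 z0) -/(backward_drift f (D0log f) (pull z)).
  apply: (bound _ _ _ _ c2 n2).
  by move: (backward_drift _ _ _) (drift_remainder _ _ _) => a b; ring.
Qed.
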